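(* Let $n\ge 2$ and let $i_1,\ldots,i_n$ be distinct non-zero real numbers from the interval $(-2,n]$. Let $\mathcal{E}_1$ and $\mathcal{E}_2$ be two ellipsoids in $\mathbb{R}^n$ centered at the origin such that $\widetilde V_{i_k}(\mathcal{E}_1)=\widetilde V_{i_k}(\mathcal{E}_2)$ for every $k=1,\ldots,n$. Then $\mathcal{E}_1$ and $\mathcal{E}_2$ are congruent.
   Context: An ellipsoid in $\mathbb{R}^n$ centered at the origin is the image, under some orthogonal transformation, of a set of the form $\{x\in\mathbb{R}^n: \frac{x_1^2}{a_1^2}+\cdots+\frac{x_n^2}{a_n^2}\le 1\}$ with semi-axes $a_1,\ldots,a_n>0$. For a star body $K\subset\mathbb{R}^n$ (in particular an ellipsoid centered at the origin) the radial function is $\rho_K(\theta)=\max\{a\ge 0: a\theta\in K\}$, $\theta\in S^{n-1}$. For every real number $i$, the dual volume of $K$ of order $i$ is $$\widetilde V_i(K)=\frac1n\int_{S^{n-1}}\rho_K(\theta)^i\,d\theta,$$ where the integration is with respect to the spherical Lebesgue (surface) measure on $S^{n-1}$. Two sets are congruent if one is the image of the other under an isometry of $\mathbb{R}^n$. *)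

(* Defs.v *)
From HB Require Import structures.
From mathcomp Require Import all_boot all_order all_algebra.
From mathcomp Require Import all_classical all_reals all_analysis.
From mathcomp Require Import measurable_realfun.

Set Implicit Arguments.
Unset Strict Implicit.
Unset Printing Implicit Defensive.

Import Order.TTheory GRing.Theory Num.Theory.
Import numFieldNormedType.Exports.

Local Open Scope classical_set_scope.
Local Open Scope ring_scope.

Fact rV_display : measure_display.
Proof. by []. Qed.

Section measurable_rV.
Context {R : realType} (n : nat).

Let coor (i : 'I_n) (x : 'rV[R]_n) : measurableTypeR R := x 0 i.

Let rV_set0 : g_sigma_preimage coor set0.
Proof. exact: sigma_algebra0. Qed.

Let rV_setC A : g_sigma_preimage coor A -> g_sigma_preimage coor (~` A).
Proof. exact: sigma_algebraC. Qed.

Let rV_bigcup (F : (set 'rV[R]_n)^nat) :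
  (forall i, g_sigma_preimage coor (F i)) ->
  g_sigma_preimage coor (\bigcup_i (F i)).
Proof. exact: sigma_algebra_bigcup. Qed.

(* The sigma-algebra generated by the coordinate functions, i.e. the Borel sets
   of R^n. *)
HB.instance Definition _ := @isMeasurable.Build rV_display 'rV[R]_n
  (g_sigma_preimage coor) rV_set0 rV_setC rV_bigcup.

Lemma measurable_coor (i : 'I_n) :
  measurable_fun [set: 'rV[R]_n] (fun x => x 0 i : measurableTypeR R).
Proof.
move=> _ Y mY; rewrite setTI; apply: sub_sigma_algebra => /=.
rewrite -bigcup_seq/=; exists i => /=; first by rewrite mem_index_enum.
by exists Y => //; rewrite setTI.
Qed.

Lemma measurable_fun_coorP d (T : measurableType d) (f : T -> 'rV[R]_n) :
  (forall i, measurable_fun [set: T] (fun t => f t 0 i : measurableTypeR R)) ->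
  measurable_fun [set: T] f.
Proof.
move=> mf; have sub : g_sigma_preimage (fun i => coor i \o f) `<=` measurable.
  apply: smallest_sub; first exact: sigma_algebra_measurable.
  rewrite -bigcup_seq; apply: bigcup_sub => i _ A [B mB <-].
  exact: mf.
by move=> _ A mA; apply: sub; rewrite g_sigma_preimage_comp; exists A.
Qed.

End measurable_rV.

Section lebesgue_rV.
Context {R : realType}.

Definition rV_cons n (p : measurableTypeR R * 'rV[R]_n) : 'rV[R]_n.+1 :=
  \row_i (if unlift ord0 i is Some j then p.2 0 j else p.1).

Definition rV_uncons n (x : 'rV[R]_n.+1) : measurableTypeR R * 'rV[R]_n :=
  (x 0 ord0, \row_j x 0 (lift ord0 j)).

Lemma rV_consK n : cancel (@rV_cons n) (@rV_uncons n).
Proof.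
move=> [a v]; rewrite /rV_uncons /rV_cons mxE unlift_none; congr pair.
by apply/rowP => j; rewrite !mxE liftK.
Qed.

Lemma measurable_rV_cons n : measurable_fun [set: _] (@rV_cons n).
Proof.
apply: measurable_fun_coorP => i; rewrite /rV_cons.
under eq_fun do rewrite mxE.
case: unliftP => [j _|_]; last exact: measurable_fst.
exact: (measurableT_comp (measurable_coor j) measurable_snd).
Qed.

Lemma measurable_rV_uncons n : measurable_fun [set: _] (@rV_uncons n).
Proof.
apply: measurable_fun_pair; first exact: measurable_coor.
apply: measurable_fun_coorP => i.
by under eq_fun do rewrite mxE; exact: measurable_coor.
Qed.

Section step.
Context n (mu : {sigma_finite_measure set 'rV[R]_n -> \bar R}).

Definition lebesgue_rV_step : set 'rV[R]_n.+1 -> \bar R :=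
  pushforward (lebesgue_measure \x mu)%E (@rV_cons n).

Let image : {measure set 'rV[R]_n.+1 -> \bar R} :=
  measure_function_pushforward__canonical__measure_function_Measure
    (lebesgue_measure \x mu)%E (@measurable_rV_cons n).

Let step_sigma_finite : sigma_finite setT lebesgue_rV_step.
Proof.
have /sigma_finiteP[F [TF ndF Foo]] := sigma_finiteT (@lebesgue_measure R).
have /sigma_finiteP[G [TG ndG Goo]] := sigma_finiteT mu.
exists (fun k => @rV_uncons n @^-1` (F k `*` G k)).
  rewrite -preimage_bigcup; apply/seteqP; split => // x _ /=.
  have [k _ Fk] : (\bigcup_k F k) (rV_uncons x).1 by rewrite -TF.
  have [l _ Gl] : (\bigcup_k G k) (rV_uncons x).2 by rewrite -TG.
  exists (maxn k l) => //; split.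
    by move: Fk; exact/subsetPset/ndF/leq_maxl.
  by move: Gl; exact/subsetPset/ndG/leq_maxr.
move=> k; have [mF Fk] := Foo k; have [mG Gk] := Goo k; split.
  by rewrite -[X in measurable X]setTI; apply: measurable_rV_uncons => //;
    exact: measurableX.
rewrite /lebesgue_rV_step /pushforward -comp_preimage.
rewrite (_ : _ \o _ = id); last by apply/funext => x /=; exact: rV_consK.
by rewrite preimage_id product_measure1E// lte_mul_pinfty// ge0_fin_numE.
Qed.

HB.instance Definition _ := isMeasure.Build _ _ _ lebesgue_rV_step
  (measure0 image) (measure_ge0 image) (@measure_semi_sigma_additive _ _ _ image).

HB.instance Definition _ := Measure_isSigmaFinite.Build _ _ _ lebesgue_rV_step
  step_sigma_finite.

End step.

(* Lebesgue measure on the Borel sets of R^n, as the n-fold product of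
   Lebesgue measure on R. *)
Fixpoint lebesgue_rV (n : nat) : {sigma_finite_measure set 'rV[R]_n -> \bar R} :=
  match n return {sigma_finite_measure set 'rV[R]_n -> \bar R} with
  | 0 => dirac (0 : 'rV[R]_0)
  | m.+1 => lebesgue_rV_step (lebesgue_rV m)
  end.

End lebesgue_rV.

Section euclidean.
Context {R : realType} (n : nat).
Implicit Types (x y theta : 'rV[R]_n) (A K E : set 'rV[R]_n).

(* The library norm `|x| on 'rV[R]_n is the sup norm. *)
Definition enorm x : R := Num.sqrt (\sum_i x 0 i ^+ 2).

Definition unit_sphere : set 'rV[R]_n := [set theta | enorm theta = 1].

Lemma enorm_ge0 x : 0 <= enorm x. Proof. exact: sqrtr_ge0. Qed.

Lemma enormZ r x : 0 <= r -> enorm (r *: x) = r * enorm x.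
Proof.
move=> r0; rewrite /enorm (eq_bigr (fun i => r ^+ 2 * x 0 i ^+ 2)).
  by rewrite -mulr_sumr sqrtrM ?sqr_ge0// sqrtr_sqr ger0_norm.
by move=> i _; rewrite mxE exprMn.
Qed.

Definition sphere_cone A : set 'rV[R]_n :=
  [set x | exists r theta,
     [/\ 0 < r <= 1, unit_sphere theta, A theta & x = r *: theta]].

Local Notation D := [set x | 0 < enorm x <= 1].
Local Notation dir := (fun x => (enorm x)^-1 *: x).

Lemma sphere_coneE A : sphere_cone A = dir @^-1` A `&` D.
Proof.
apply/seteqP; split => [x [r [theta [/andP[r0 r1] t1 At ->]]]|x [Ax /andP[x0 x1]]] /=.
  rewrite (enormZ _ (ltW r0)) t1 mulr1; split; last exact/andP.
  by rewrite scalerA mulVf ?scale1r// gt_eqF.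
exists (enorm x), ((enorm x)^-1 *: x); rewrite x0 x1; split => //.
  by rewrite /unit_sphere/= enormZ ?invr_ge0 ?enorm_ge0// mulVf// gt_eqF.
by rewrite scalerA mulfV ?scale1r// gt_eqF.
Qed.

Lemma measurable_enorm : measurable_fun [set: 'rV[R]_n] enorm.
Proof.
apply: measurableT_comp.
  by apply: continuous_measurable_fun; exact: sqrt_continuous.
apply: measurable_sum => i; apply: measurable_funX; exact: measurable_coor.
Qed.

Let measurable_dir : measurable_fun [set: 'rV[R]_n] dir.
Proof.
apply: measurable_fun_coorP => i; under eq_fun do rewrite mxE.
apply: measurable_funM; last exact: measurable_coor.
under eq_fun do rewrite -powR_inv1 ?enorm_ge0//.
exact: measurableT_comp (measurable_powR _) measurable_enorm.
Qed.

Let measurable_D : measurable D.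
Proof.
have -> : D = setT `&` enorm @^-1` `]0, 1].
  by rewrite setTI; apply/seteqP; split => x /=; rewrite in_itv.
exact: measurable_enorm.
Qed.

(* Spherical Lebesgue measure on S^(n-1):
   sigma(A) = n * lambda_n {r theta | theta in A, 0 < r <= 1}. It is a measure
   on R^n concentrated on the unit sphere. *)
Definition sphere_measure A : \bar R :=
  (n%:R%:E * lebesgue_rV n (sphere_cone A))%E.

Let push : {measure set 'rV[R]_n -> \bar R} :=
  measure_function_pushforward__canonical__measure_function_Measure
    (mrestr (lebesgue_rV n) measurable_D) measurable_dir.

Let sphere_measureE : sphere_measure = mscale (NngNum (ler0n R n)) push.
Proof. by apply/funext => A; rewrite /sphere_measure sphere_coneE. Qed.

Let sphere_measure0 : sphere_measure set0 = 0%E.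
Proof. by rewrite sphere_measureE measure0. Qed.

Let sphere_measure_ge0 A : (0 <= sphere_measure A)%E.
Proof. by rewrite sphere_measureE. Qed.

Let sphere_measure_sigma_additive : semi_sigma_additive sphere_measure.
Proof. by rewrite sphere_measureE; exact: measure_semi_sigma_additive. Qed.

HB.instance Definition _ := isMeasure.Build _ _ _ sphere_measure
  sphere_measure0 sphere_measure_ge0 sphere_measure_sigma_additive.

(* For a star body the maximum exists, and sup is then its value. *)
Definition radial K theta : R := sup [set a | 0 <= a /\ K (a *: theta)].

Definition dual_volume (i : R) K : \bar R :=
  ((n%:R^-1)%:E *
   \int[sphere_measure]_(theta in unit_sphere) (radial K theta `^ i)%:E)%E.

Definition ellipsoid E : Prop :=
  exists (a : 'I_n -> R) (U : 'M[R]_n),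
    [/\ forall k, 0 < a k,
        U *m U^T = 1%:M &
        E = (fun x => x *m U) @`
            [set x : 'rV[R]_n | \sum_k x 0 k ^+ 2 / a k ^+ 2 <= 1]].

Definition isometry (f : 'rV[R]_n -> 'rV[R]_n) : Prop :=
  forall x y, enorm (f x - f y) = enorm (x - y).

Definition congruent A K : Prop :=
  exists2 f, isometry f & K = f @` A.

End euclidean.

(* Main.v *)
Require Import Defs.
From mathcomp Require Import all_boot all_order all_algebra.
From mathcomp Require Import all_classical all_reals all_analysis.
From mathcomp Require Import measurable_realfun gauss_integral perm.
From mathcomp Require Import ring lra zify.

(** An ellipsoid is the set where Q <= 1, with Q (x) = x M x^T positive
definite; the eigenvalues x_k of M are the inverse squares of the semi-axes.
Its radial function on the sphere is Q^(-1/2), so that its dual volume of order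
i is the integral over the unit ball of the 0-homogeneous function
(|x|^2 / Q (x))^(i/2) ([dual_volume_qball]).

For a 0-homogeneous function the integral over the unit ball determines its
integral against every radial weight, by Tonelli's theorem and the scaling of
Lebesgue measure ([polar_exchange]). With the weight
exp (- |x|^2) * \int_0^oo s^(i/2 - 1) k (s |x|^2) ds the powers of Q and |x|^2
are absorbed by a rescaling of s ([ratio_pow_kernel]), and the dual volume
determines
    \int_0^oo s^(i/2 - 1) (\int exp (- |x|^2) k (s Q (x)) dx) ds.
For k (t) = exp (- t) the inner integral is Gaussian, a constant multiple of
p (s)^(-1/2) where p (s) = det (1 + s M) = prod_k (1 + s x_k) is called the
pencil of the ellipsoid. Hence the dual volume of order i determines the
moment of order i/2 of p^(-1/2) for 0 < i < n ([moment_pos]), and that of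
1 - p^(-1/2) for -2 < i < 0, where k (t) = 1 - exp (- t) restores convergence
at s = 0 ([moment_neg]). The order i = n gives the volume, that is
det M = prod_k x_k ([moment_dim]).

Let p1 and p2 be the pencils of two ellipsoids with the same dual volumes.
Then p1^(-1/2) - p2^(-1/2) is orthogonal to n distinct powers of s, or to n - 1
of them when the order n occurs. Its sign is that of the polynomial
(p2 - p1) / s, of degree less than n, and less than n - 1 when the order n
occurs, since the leading coefficients then agree. Real powers form a
Chebyshev system: some combination of the available powers changes sign
exactly where this polynomial does ([expsum_sign], [expsum_interpolation]). Its
product with the difference has constant sign and integral zero, hence p1 = p2
([poly_vanish]). The roots of the pencil are the - 1 / x_k, so the semi-axes
agree up to order, and ellipsoids with the same semi-axes are congruent.

On the half-line the variable is written s = exp u with u real, so that ds / s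
becomes Lebesgue measure and powers of s become exponentials. *)

Set Implicit Arguments.
Unset Strict Implicit.
Unset Printing Implicit Defensive.

Import Order.TTheory GRing.Theory Num.Theory.
Import numFieldNormedType.Exports.
Local Open Scope classical_set_scope.
Local Open Scope ring_scope.

(** * Affine changes of variable on the line and scaling in several dimensions *)

Section affine.
Context {R : realType}.
Local Notation mu := (@lebesgue_measure R).
Variables (a b : R).
Hypothesis a0 : 0 < a.

Let phi : measurableTypeR R -> measurableTypeR R := fun x => a * x + b.

Let mphi : measurable_fun [set: _] phi.
Proof. by apply: measurable_funD => //; apply: measurable_funM. Qed.

Let push : {measure set (measurableTypeR R) -> \bar R} :=
  measure_function_pushforward__canonical__measure_function_Measure mu mphi.

Let a_nng : {nonneg R} := NngNum (ltW a0).

Let lebesgue_affine (A : set (measurableTypeR R)) : measurable A -> mu A = mscale a_nng push A.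
Proof.
apply: lebesgue_measure_unique => _ [[c d]] _ <-.
change (mu `]c, d] = a%:E * mu (phi @^-1` `]c, d]))%E.
have -> : phi @^-1` [set` `]c, d]] = `](c - b) / a, (d - b) / a]%classic.
  apply/seteqP; split => x /=; rewrite !in_itv /= ltr_pdivrMr// ler_pdivlMr// /phi; lra.
rewrite !lebesgue_measure_itv/= !lte_fin ltr_pM2r ?invr_gt0// ltrD2r.
case: ifPn => _; rewrite ?mule0//.
rewrite -!EFinB -EFinM; congr EFin.
by field; rewrite gt_eqF.
Qed.

(** Lebesgue measure is the only measure with the right value on intervals, and
the affine image rescaled by a has it. *)
Lemma ge0_integral_affine (f : R -> \bar R) :
  measurable_fun [set: measurableTypeR R] f -> (forall x, 0 <= f x)%E ->
  (\int[mu]_x f x = a%:E * \int[mu]_x f (a * x + b)%R)%E.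
Proof.
move=> mf f0.
rewrite (eq_measure_integral (mscale a_nng push)); last first.
  by move=> A mA _; exact: lebesgue_affine.
rewrite ge0_integral_mscale//; congr (_ * _)%E.
by rewrite ge0_integral_pushforward.
Qed.

End affine.

Section rV.
Context {R : realType}.
Local Notation mu := (@lebesgue_measure R).
Local Notation lam n := (@lebesgue_rV R n).

Lemma integral_lebesgue_rVS n (f : 'rV[R]_n.+1 -> \bar R) :
  measurable_fun [set: _] f -> (forall x, 0 <= f x)%E ->
  (\int[lam n.+1]_x f x = \int[mu]_a \int[lam n]_v f (rV_cons (a, v)))%E.
Proof.
move=> mf f0.
have mc := @measurable_rV_cons R n.
transitivity (\int[pushforward (mu \x lam n) (@rV_cons R n)]_x f x)%E.
  by apply: eq_measure_integral.
rewrite (ge0_integral_pushforward mc)// preimage_setT.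
rewrite fubini_tonelli1//=; last exact: measurableT_comp mf mc.
Qed.

Lemma integral_lebesgue_rVS_swap n (f : 'rV[R]_n.+1 -> \bar R) :
  measurable_fun [set: _] f -> (forall x, 0 <= f x)%E ->
  (\int[lam n.+1]_x f x = \int[lam n]_v \int[mu]_a f (rV_cons (a, v)))%E.
Proof.
move=> mf f0; rewrite integral_lebesgue_rVS//.
apply: (fubini_tonelli (fun p => f (rV_cons p))) => //.
exact: measurableT_comp mf (@measurable_rV_cons R n).
Qed.

Lemma measurable_rV_scale n (r : R) :
  measurable_fun [set: 'rV[R]_n] (fun x : 'rV[R]_n => r *: x).
Proof.
apply: measurable_fun_coorP => i; under eq_fun do rewrite mxE.
by apply: measurable_funM => //; exact: measurable_coor.
Qed.

Lemma rV_consZ n r a (v : 'rV[R]_n) : r *: rV_cons (a, v) = rV_cons (r * a, r *: v).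
Proof. by apply/rowP => i; rewrite !mxE; case: unliftP => [j|] _ //=; rewrite mxE. Qed.

(** Induction on the dimension: each coordinate contributes one factor r by the
one-dimensional case. *)
Lemma ge0_integral_rV_scale n (r : R) (f : 'rV[R]_n -> \bar R) : 0 < r ->
  measurable_fun [set: _] f -> (forall x, 0 <= f x)%E ->
  (\int[lam n]_x f x = (r ^+ n)%:E * \int[lam n]_x f (r *: x)%R)%E.
Proof.
move=> r0; elim: n f => [|n IH] f mf f0.
  by rewrite expr0 mul1e; apply: eq_integral => x _; rewrite [r *: x]thinmx0 [x]thinmx0.
have mfc := measurableT_comp mf (@measurable_rV_cons R n).
have mcons a : measurable_fun [set: 'rV[R]_n] (fun v => rV_cons (a, v)).
  apply: measurableT_comp; first exact: measurable_rV_cons.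
  exact: pair1_measurable.
pose g a := (\int[lam n]_v f (rV_cons (a, r *: v)))%E.
have mg : measurable_fun [set: measurableTypeR R] g.
  apply: (measurable_fun_fubini_tonelli_F
    (fun p : measurableTypeR R * 'rV[R]_n => f (rV_cons (p.1, r *: p.2)))) => //.
  apply: (measurableT_comp mfc).
  apply: measurable_fun_pair => //.
  exact: (measurableT_comp (measurable_rV_scale r)).
have g0 a : (0 <= g a)%E by exact: integral_ge0.
rewrite integral_lebesgue_rVS//.
transitivity (\int[mu]_a ((r ^+ n)%:E * g a))%E.
  by apply: eq_integral => a _; rewrite IH//; exact: measurableT_comp mf (mcons a).
rewrite ge0_integralZl//; last by rewrite lee_fin exprn_ge0// ltW.
rewrite (@ge0_integral_affine _ r 0)// integral_lebesgue_rVS//; last first.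
  exact: measurableT_comp mf (measurable_rV_scale r).
rewrite muleA -EFinM -exprSr; congr (_ * _)%E.
apply: eq_integral => a _; rewrite addr0.
by apply: eq_integral => v _; rewrite rV_consZ.
Qed.
End rV.

(** * Gaussian integrals of quadratic forms *)

Section qform.
Context {R : realType}.
Local Notation mu := (@lebesgue_measure R).
Local Notation lam n := (@lebesgue_rV R n).

Definition qform n (M : 'M[R]_n) (x : 'rV[R]_n) : R := (x *m M *m x^T) 0 0.

Definition posdef n (M : 'M[R]_n) := forall x, x != 0 -> 0 < qform M x.

Lemma qformE n (M : 'M[R]_n) x :
  qform M x = \sum_j (\sum_i x 0 i * M i j) * x 0 j.
Proof. by rewrite /qform mxE; apply: eq_bigr => j _; rewrite !mxE. Qed.

Lemma measurable_qform n (M : 'M[R]_n) :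
  measurable_fun [set: 'rV[R]_n] (fun x => qform M x : measurableTypeR R).
Proof.
under eq_fun do rewrite qformE.
apply: measurable_sum => j; apply: measurable_funM; last exact: measurable_coor.
apply: measurable_sum => i; apply: measurable_funM => //; exact: measurable_coor.
Qed.

Lemma qformZ n (M : 'M[R]_n) r x : qform M (r *: x) = r ^+ 2 * qform M x.
Proof.
by rewrite /qform linearZ /= -scalemxAr -!scalemxAl !mxE expr2 mulrA.
Qed.

Lemma rV_consE n a (v : 'rV[R]_n) : rV_cons (a, v) = row_mx (a%:M) v :> 'rV_(1 + n).
Proof.
apply/rowP => i; rewrite !mxE; case: unliftP => [j ->|->]; case: splitP => // k.
- by rewrite /= => /eqP; case: k => -[].
- by rewrite /= => /eqP; rewrite eqn_add2l => /eqP jk; congr (v 0 _); exact: val_inj.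
- by rewrite mxE; case: k => -[] //= k0 _; rewrite mulr1n.
Qed.

(** Completing the square in the first coordinate leaves the quadratic form of
the Schur complement in the others. *)
Lemma qform_block n (m : R) (b : 'rV[R]_n) (D : 'M[R]_n) a v : m != 0 ->
  qform (block_mx m%:M b b^T D : 'M[R]_(1 + n)) (rV_cons (a, v)) =
  m * (a + (v *m b^T) 0 0 / m) ^+ 2 + qform (D - m^-1 *: (b^T *m b)) v.
Proof.
move=> m0; rewrite /qform rV_consE mul_row_block tr_row_mx mul_row_col.
rewrite mulmxBr mulmxBl -scalemxAr -scalemxAl mulmxA -(mulmxA (v *m _)).
rewrite !mulmxDl tr_scalar_mx -scalar_mxM !mul_scalar_mx !mul_mx_scalar -scalemxAl.
have -> : b *m v^T = (v *m b^T)^T by rewrite trmx_mul trmxK.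
set c := v *m b^T.
rewrite !mxE !eqxx !mulr1n big_ord1 !mxE.
set X := \sum_j _.
by field.
Qed.

Lemma qform_block_corner n (m : R) (b : 'rV[R]_n) (D : 'M[R]_n) :
  qform (block_mx m%:M b b^T D : 'M[R]_(1 + n)) (rV_cons (1, 0)) = m.
Proof.
rewrite /qform rV_consE mul_row_block tr_row_mx mul_row_col.
by rewrite mul1mx !mul0mx !addr0 trmx0 mulmx0 addr0 trmx1 mulmx1 mxE eqxx mulr1n.
Qed.

Lemma det_block_schur n (m : R) (b : 'rV[R]_n) (D : 'M[R]_n) : m != 0 ->
  \det (block_mx m%:M b b^T D : 'M[R]_(1 + n)) = m * \det (D - m^-1 *: (b^T *m b)).
Proof.
move=> m0.
pose L : 'M[R]_(1 + n) := block_mx 1%:M 0 (- m^-1 *: b^T) 1%:M.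
have dL : \det L = 1 by rewrite det_lblock !det1 mulr1.
rewrite -[LHS]mul1r -dL -det_mulmx mulmx_block !mul1mx !mul0mx !addr0.
rewrite mul_mx_scalar scalerA mulrN mulfV// scaleN1r addNr det_ublock.
by rewrite det_scalar1 scaleNr mulNmx addrC -scalemxAl.
Qed.

Definition gauss_const : R := Num.sqrt pi.

Lemma gauss_affine (m c : R) : 0 < m ->
  (\int[mu]_a (expR (- (m * (a + c) ^+ 2)))%:E = (gauss_const / Num.sqrt m)%:E)%E.
Proof.
move=> m0; have s0 : 0 < Num.sqrt m by rewrite sqrtr_gt0.
have := @integralT_gauss R.
rewrite (@ge0_integral_affine _ (Num.sqrt m) (Num.sqrt m * c))//; last 2 first.
  by apply/measurable_EFinP; exact: measurable_gauss_fun.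
  by move=> x; rewrite lee_fin gauss_fun_ge0.
rewrite (_ : integral _ _ _ = \int[mu]_a (expR (- (m * (a + c) ^+ 2)))%:E)%E; last first.
  apply: eq_integral => a _; rewrite /gauss_fun -mulrDr exprMn sqr_sqrtr ?ltW//.
set I := (X in (_ * X)%E) => /(congr1 (fun x => (Num.sqrt m)^-1%:E * x)%E).
rewrite muleA -!EFinM mulVf ?gt_eqF// mul1e => h; rewrite -[LHS]/I h.
by rewrite mulrC.
Qed.

(** The first coordinate is integrated first: completing the square yields a
one-dimensional Gaussian and the Gaussian of the Schur complement, whose
determinant is that of M divided by the corner entry. *)
Lemma posdef_det_gauss n (M : 'M[R]_n) : M^T = M -> posdef M ->
  0 < \det M /\
  (\int[lam n]_x (expR (- qform M x))%:E = (gauss_const ^+ n / Num.sqrt (\det M))%:E)%E.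
Proof.
elim: n M => [|n IH] M sM pM.
  rewrite det_mx00; split=> //.
  rewrite /= integral_dirac//=; last first.
    apply/measurable_EFinP; apply: measurableT_comp => //.
    by apply: measurableT_comp => //; exact: measurable_qform.
  by rewrite diracT mul1e qformE big_ord0 oppr0 expR0 sqrtr1 expr0 divr1.
have mexp : measurable_fun setT (fun x => (expR (- qform M x))%:E).
  apply/measurable_EFinP; apply: measurableT_comp => //.
  by apply: measurableT_comp => //; exact: measurable_qform.
rewrite integral_lebesgue_rVS_swap//.
have [m [b [D ME]]] : exists m b D, M = block_mx m%:M b b^T D :> 'M[R]_(1 + n).
  exists (M 0 0), (@ursubmx _ 1 n 1 n M), (@drsubmx _ 1 n 1 n M).
  rewrite -[LHS](@submxK _ 1 n 1 n); congr block_mx.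
    by apply/matrixP => i j; rewrite !ord1 !mxE mulr1n; congr (M _ _); exact: val_inj.
  by rewrite trmx_ursub sM.
have m0 : 0 < m.
  have /pM : rV_cons (1, 0 : 'rV[R]_n) != 0.
    apply/eqP => /rowP/(_ ord0); rewrite !mxE unlift_none => /eqP.
    by rewrite oner_eq0.
  by rewrite ME qform_block_corner.
have mn0 : m != 0 by rewrite gt_eqF.
pose S := D - m^-1 *: (b^T *m b).
have DT : D^T = D.
  move: sM; rewrite ME (@tr_block_mx _ 1 n 1 n) => /(@eq_block_mx _ 1 n 1 n).
  by move=> [].
have sS : S^T = S.
  by rewrite /S linearB/= linearZ/= trmx_mul trmxK DT.
have pS : posdef S.
  move=> v v0; have /pM : rV_cons (- ((v *m b^T) 0 0 / m), v) != 0.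
    apply: contraNN v0 => /eqP/rowP h; apply/eqP/rowP => j.
    by have := h (lift ord0 j); rewrite !mxE liftK.
  by rewrite ME qform_block// addNr expr0n mulr0 add0r.
have [dS IS] := IH _ sS pS.
have dM : \det M = m * \det S by rewrite ME det_block_schur.
split; first by rewrite dM mulr_gt0.
transitivity (\int[lam n]_v ((gauss_const / Num.sqrt m)%:E * (expR (- qform S v))%:E))%E.
  apply: eq_integral => v _.
  transitivity (\int[mu]_a ((expR (- qform S v))%:E *
     (expR (- (m * (a + (v *m b^T) 0 0 / m) ^+ 2)))%:E))%E.
    by apply: eq_integral => a _; rewrite ME qform_block// opprD expRD EFinM muleC.
  rewrite ge0_integralZl//; last first.
    apply/measurable_EFinP; apply: measurableT_comp => //.
    apply: measurableT_comp => //; apply: measurable_funM => //.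
    by apply: measurable_funX; exact: measurable_funD.
  by rewrite gauss_affine// muleC.
rewrite ge0_integralZl//; last 2 first.
  apply/measurable_EFinP; apply: measurableT_comp => //.
  by apply: measurableT_comp => //; exact: measurable_qform.
  by rewrite lee_fin divr_ge0 ?sqrtr_ge0.
rewrite IS -EFinM dM sqrtrM ?(ltW m0)// exprS.
congr EFin; field.
by rewrite !sqrtr_eq0 -!ltNge m0 dS.
Qed.
End qform.

(** * The exchange identity for homogeneous functions *)

Section haar.
Context {R : realType}.
Local Notation mu := (@lebesgue_measure R).
Local Notation lam n := (@lebesgue_rV R n).

Lemma measurable_expR_comp (f : R -> \bar R) :
  measurable_fun [set: measurableTypeR R] f ->
  measurable_fun [set: measurableTypeR R] (fun u : measurableTypeR R => f (expR u)).
Proof. by move=> mf; apply: (measurableT_comp mf). Qed.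

(** The push-forward of Lebesgue measure by exp is the measure ds / s, which is
invariant under dilations. *)
Lemma haarZ (c : R) (f : R -> \bar R) : 0 < c ->
  measurable_fun [set: measurableTypeR R] f -> (forall x, 0 <= f x)%E ->
  (\int[mu]_u f (c * expR u)%R = \int[mu]_u f (expR u))%E.
Proof.
move=> c0 mf f0.
rewrite [RHS](@ge0_integral_affine _ 1 (ln c))//; last exact: measurable_expR_comp.
by rewrite mul1e; apply: eq_integral => u _; rewrite mul1r expRD lnK ?posrE// mulrC.
Qed.
End haar.

Section polar.
Context {R : realType} (n : nat).
Local Notation mu := (@lebesgue_measure R).
Local Notation lam := (@lebesgue_rV R n).
Local Notation rV := 'rV[R]_n.
Variables (g : rV -> R) (N Q : rV -> R) (chi : R -> R) (phi : R -> \bar R).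
Hypotheses (mg : measurable_fun [set: rV] (g : rV -> measurableTypeR R))
  (mN : measurable_fun [set: rV] (N : rV -> measurableTypeR R))
  (mQ : measurable_fun [set: rV] (Q : rV -> measurableTypeR R))
  (mchi : measurable_fun [set: measurableTypeR R] (chi : measurableTypeR R -> measurableTypeR R))
  (mphi : measurable_fun [set: measurableTypeR R] phi).
Hypotheses (g_ge0 : forall x, 0 <= g x) (chi0 : forall v, 0 <= chi v)
  (phi0 : forall v, (0 <= phi v)%E) (g0 : g 0 = 0).
Hypotheses (gZ : forall r x, 0 < r -> g (r *: x) = g x)
  (NZ : forall r x, 0 < r -> N (r *: x) = r ^+ 2 * N x)
  (QZ : forall r x, 0 < r -> Q (r *: x) = r ^+ 2 * Q x)
  (N_gt0 : forall x, x != 0 -> 0 < N x)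
  (Q_gt0 : forall x, x != 0 -> 0 < Q x).
Let p : R := n%:R / 2.

(** Multiply the two integrals on the left, and substitute in turn
s := Q (x) s, then x := s^(-1/2) x, then s := s / N (x). Homogeneity moves the
weights chi and phi from one variable to the other. With chi the indicator of
[0, 1] this computes the integral of g against the radial weight given by phi
from the integral of g over the ball; with Q different from N it also compares
the balls of two quadratic forms. *)
Lemma polar_exchange :
  ((\int[lam]_x (g x * chi (N x))%:E) * (\int[mu]_u phi (expR u)) =
  (\int[lam]_x ((g x * N x `^ (- p))%:E * phi (Q x))) *
    \int[mu]_u (chi (expR (- u)) * expR u `^ (- p))%:E)%E.
Proof.
have mgchi : measurable_fun [set: rV] (fun x => g x * chi (N x) : measurableTypeR R).
  by apply: measurable_funM => //; exact: (measurableT_comp mchi mN).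
have mphie := measurable_expR_comp mphi.
rewrite -ge0_integralZr//; last 3 first.
  by apply/measurable_EFinP.
  by move=> x _; rewrite lee_fin mulr_ge0.
  by apply: integral_ge0.
transitivity (\int[lam]_x \int[mu]_u
   ((g x * chi (N x))%:E * phi (Q x * expR u)%R))%E.
  apply: eq_integral => x _.
  have [->|x0] := eqVneq x 0.
    by rewrite g0 !mul0r mul0e; under eq_integral do rewrite mul0e; rewrite integral0.
  rewrite ge0_integralZl//; last 2 first.
    apply: (measurableT_comp mphi); apply: measurable_funM => //.
    by rewrite lee_fin mulr_ge0.
  by rewrite haarZ// Q_gt0.
rewrite (fubini_tonelli (fun z : rV * measurableTypeR R =>
  (g z.1 * chi (N z.1))%:E * phi (Q z.1 * expR z.2)%R)%E)//=; last 2 first.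
  apply: emeasurable_funM.
    by apply/measurable_EFinP; apply: (measurableT_comp mgchi).
  apply: (measurableT_comp mphi); apply: measurable_funM => //.
    by apply: (measurableT_comp mQ).
  by apply: (measurableT_comp (f := expR)).
  by move=> z; rewrite mule_ge0// lee_fin mulr_ge0.
transitivity (\int[mu]_u \int[lam]_x
   ((g x)%:E * phi (Q x) * (chi (N x / expR u) * expR u `^ (- p))%:E))%E.
  apply: eq_integral => u _.
  have r0 : 0 < expR (- (u / 2)) by rewrite expR_gt0.
  (* The scaling factor r = s^(-1/2) satisfies r^2 = 1 / s and r^n = s^(-p). *)
  have r2 : expR (- (u / 2)) ^+ 2 = (expR u)^-1.
    by rewrite -expRM_natl -expRN; congr expR; field.
  have rn : expR (- (u / 2)) ^+ n = expR u `^ (- p).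
    rewrite -expRM_natl /powR gt_eqF ?expR_gt0// expRK /p; congr expR.
    by field.
  have mF : measurable_fun [set: rV] (fun x => (g x * chi (N x))%:E * phi (Q x * expR u)%R)%E.
    apply: emeasurable_funM; first exact/measurable_EFinP.
    by apply: (measurableT_comp mphi); apply: measurable_funM => //.
  rewrite [LHS](ge0_integral_rV_scale r0)//; last first.
    by move=> x /=; rewrite mule_ge0// lee_fin mulr_ge0.
  rewrite -ge0_integralZl//; last 2 first.
    apply: (measurableT_comp mF); exact: measurable_rV_scale.
    by move=> x _ /=; rewrite mule_ge0// lee_fin mulr_ge0.
  apply: eq_integral => x _; rewrite gZ// NZ// QZ// r2 rn.
  rewrite mulrAC mulVf ?gt_eqF ?expR_gt0// mul1r [_^-1 * N x]mulrC.
  by rewrite [in RHS]EFinM [RHS]muleACA -EFinM [LHS]muleCA [(phi _ * _)%E]muleC.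
rewrite -(fubini_tonelli (fun z : rV * measurableTypeR R =>
  ((g z.1)%:E * phi (Q z.1) * (chi (N z.1 / expR z.2) * expR z.2 `^ (- p))%:E))%E)//=; last 2 first.
  apply: emeasurable_funM.
    apply: emeasurable_funM.
      by apply/measurable_EFinP; apply: (measurableT_comp mg).
    by apply: (measurableT_comp mphi); apply: (measurableT_comp mQ).
  apply/measurable_EFinP; apply: measurable_funM => //.
    apply: (measurableT_comp mchi); apply: measurable_funM => //.
      by apply: (measurableT_comp mN).
    under eq_fun do rewrite -expRN.
    by apply: (measurableT_comp (f := expR)) => //; apply: measurableT_comp.
  apply: (measurableT_comp (measurable_powR _)) => //.
  by apply: (measurableT_comp (f := expR)).
  move=> z; apply: mule_ge0; last by rewrite lee_fin; apply: mulr_ge0 => //; exact: powR_ge0.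
  by apply: mule_ge0; rewrite ?lee_fin.
rewrite -ge0_integralZr//; last 3 first.
  apply: emeasurable_funM.
    apply/measurable_EFinP; apply: measurable_funM => //.
    by apply: (measurableT_comp (measurable_powR _)).
  exact: (measurableT_comp mphi).
  by move=> x _; rewrite mule_ge0// lee_fin mulr_ge0// powR_ge0.
  by apply: integral_ge0 => u _; rewrite lee_fin mulr_ge0// powR_ge0.
apply: eq_integral => x _.
have [->|x0] := eqVneq x 0.
  by rewrite g0 !mul0r !mul0e; under eq_integral do rewrite mul0e; rewrite integral0.
have Nx0 := N_gt0 x0.
pose kap u : \bar R := (chi (expR (- u)) * expR u `^ (- p))%:E.
have mkap : measurable_fun [set: measurableTypeR R] kap.
  apply/measurable_EFinP; apply: measurable_funM.
    apply: (measurableT_comp mchi); apply: (measurableT_comp (f := expR)) => //.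
  apply: (measurableT_comp (measurable_powR _)) => //.
have kap0 v : (0 <= kap v)%E by rewrite lee_fin mulr_ge0// powR_ge0.
rewrite [X in _ = (_ * X)%E](@ge0_integral_affine _ 1 (- ln (N x)))// mul1e.
have mk : measurable_fun [set: measurableTypeR R]
    (fun u : measurableTypeR R => chi (N x / expR u) * expR u `^ (- p) : measurableTypeR R).
  apply: measurable_funM.
    apply: (measurableT_comp mchi); apply: measurable_funM => //.
    under eq_fun do rewrite -expRN.
    by apply: (measurableT_comp (f := expR)).
  by apply: (measurableT_comp (measurable_powR _)).
rewrite [LHS]ge0_integralZl; [|exact: measurableT|..]; first last.
- by apply: mule_ge0 => //; rewrite lee_fin.
- by move=> u _; rewrite lee_fin; apply: mulr_ge0 => //; exact: powR_ge0.
- exact/measurable_EFinP.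
have -> : ((g x * N x `^ (- p))%:E * phi (Q x) = (g x)%:E * phi (Q x) * (N x `^ (- p))%:E)%E.
  by rewrite EFinM muleAC.
rewrite -[RHS]muleA; apply: (congr1 (mule _)).
rewrite -ge0_integralZl; [|exact: measurableT|..]; first last.
- by rewrite lee_fin powR_ge0.
- by move=> u _; rewrite lee_fin; apply: mulr_ge0 => //; exact: powR_ge0.
- apply: (measurableT_comp mkap (_ : measurable_fun setT (fun u : measurableTypeR R => 1 * u - ln (N x) : measurableTypeR R))).
  by apply: measurable_funD => //; exact: measurable_funM.
apply: eq_integral => u _.
have e1 : expR (- (1 * u - ln (N x))) = N x / expR u.
  by rewrite mul1r opprB expRD expRN lnK ?posrE.
have e2 : expR (1 * u - ln (N x)) = expR u / N x.
  by rewrite mul1r expRD expRN lnK ?posrE.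
have e3 : expR u `^ (- p) = N x `^ (- p) * (expR u / N x) `^ (- p).
  rewrite -powRM ?(ltW Nx0)//; first by rewrite mulrC divfK// gt_eqF.
  by rewrite divr_ge0 ?expR_ge0// ltW.
by rewrite e1 e2 e3 -EFinM mulrCA.
Qed.
End polar.

Section null.
Context {R : realType}.
Local Notation mu := (@lebesgue_measure R).
Local Notation lam n := (@lebesgue_rV R n).

(** As a real-valued function of |x|^2, this is the indicator of the unit ball. *)
Definition le1_ind (v : R) : R := \1_(`]-oo, 1]%classic) v.

Lemma le1_indE v : le1_ind v = (v <= 1)%R%:R.
Proof. by rewrite /le1_ind indicE mem_setE in_itv. Qed.

Lemma measurable_le1_ind : measurable_fun [set: measurableTypeR R] (fun v => le1_ind v : measurableTypeR R).
Proof. exact: measurable_indic. Qed.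

(** In the variable u this is the exponential distribution of rate p up to its
normalization. The point is that the value is finite and nonzero. *)
Lemma integral_unit_ball_weight (p : R) : 0 < p ->
  (\int[mu]_u (le1_ind (expR (- u)) * expR u `^ (- p))%:E = (p^-1)%:E)%E.
Proof.
move=> p0.
have := integral_exponential_pdf p0.
rewrite (_ : integral _ _ _ = p%:E * \int[mu]_u (le1_ind (expR (- u)) * expR u `^ (- p))%:E)%E.
  move/(congr1 (fun x => (p^-1)%:E * x)%E).
  by rewrite muleA -EFinM mulVf ?gt_eqF// mul1e mule1.
rewrite -ge0_integralZl//; last 3 first.
- apply/measurable_EFinP; apply: measurable_funM.
    apply: (measurableT_comp measurable_le1_ind).
    by apply: (measurableT_comp (f := expR)).
  apply: (measurableT_comp (measurable_powR _)) => //.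
- by move=> u _; rewrite lee_fin mulr_ge0// powR_ge0.
- by rewrite lee_fin ltW.
apply: eq_integral => u _; rewrite le1_indE -expR0 ler_expR oppr_le0 -EFinM.
case: leP => u0.
  by rewrite exponential_pdfE// expR0 mulr1n mul1r /powR gt_eqF ?expR_gt0// expRK mulNr.
by rewrite lt0_exponential_pdf// mul0r mulr0.
Qed.

Lemma measurable_rV0 n : measurable [set (0 : 'rV[R]_n)].
Proof.
rewrite (_ : [set 0] = \bigcap_(i in [set: 'I_n]) ((fun x : 'rV[R]_n => x 0 i : measurableTypeR R) @^-1` [set 0])); last first.
  apply/seteqP; split=> [x -> i _ /=|x h]; first by rewrite mxE.
  by apply/rowP => i; rewrite mxE; exact: (h i).
apply: fin_bigcap_measurable; first exact: finite_finset.
move=> i _; rewrite -[X in measurable X]setTI.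
by apply: measurable_coor => //; exact: measurable_set1.
Qed.

Lemma lebesgue_rV_set0 n : lam n.+1 [set 0] = 0%E.
Proof.
apply/eqP; rewrite eq_le measure_ge0 andbT.
have -> : lam n.+1 [set 0] = (mu \x lam n)%E (@rV_cons R n @^-1` [set 0]) by [].
apply: (@le_trans _ _ ((mu \x lam n)%E ([set 0] `*` setT))).
  apply: le_measure; rewrite ?inE.
  - rewrite -[X in measurable X]setTI; apply: measurable_rV_cons => //.
    exact: measurable_rV0.
  - exact: measurableX.
  by move=> [a v] /= /rowP/(_ ord0); rewrite !mxE unlift_none.
rewrite product_measure1E// [X in (X * _)%E](_ : _ = 0%E) ?mul0e//; exact: lebesgue_measure_set1.
Qed.

(** The origin, where quotients of quadratic forms have a junk value, is
negligible in positive dimension. *)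
Lemma eq_integral_rV0 n (f g : 'rV[R]_n -> \bar R) : (0 < n)%N ->
  measurable_fun [set: 'rV[R]_n] f -> measurable_fun [set: 'rV[R]_n] g ->
  (forall x, 0 <= f x)%E -> (forall x, 0 <= g x)%E ->
  (forall x, x != 0 -> f x = g x) -> (\int[lam n]_x f x = \int[lam n]_x g x)%E.
Proof.
case: n f g => // n f g _ mf mg f0 g0 fg.
apply: ge0_ae_eq_integral => //.
exists [set 0]; split; [exact: measurable_rV0|exact: lebesgue_rV_set0|].
move=> x /=; apply: contra_notP => /eqP x0 _; exact: fg.
Qed.
End null.

(** * Dual volumes as integrals over the ball *)

Section sphere.
Context {R : realType} (n : nat).
Local Notation mu := (@lebesgue_measure R).
Local Notation lam := (@lebesgue_rV R n).
Local Notation rV := 'rV[R]_n.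

Definition sqn (x : rV) : R := \sum_i x 0 i ^+ 2.

Lemma sqn_qform x : sqn x = qform 1%:M x.
Proof. by rewrite /qform mulmx1 mxE; apply: eq_bigr => i _; rewrite !mxE. Qed.

Lemma sqn_ge0 x : 0 <= sqn x.
Proof. by apply: sumr_ge0 => i _; exact: sqr_ge0. Qed.

Lemma sqn_gt0 x : x != 0 -> 0 < sqn x.
Proof.
move=> x0; rewrite lt_neqAle sqn_ge0 andbT eq_sym; apply: contraNN x0.
rewrite psumr_eq0 => [/allP h|i _]; last exact: sqr_ge0.
apply/eqP/rowP => i; apply/eqP; rewrite mxE -sqrf_eq0.
by have := h i; rewrite mem_index_enum => /(_ isT).
Qed.

Lemma sqn0 : sqn 0 = 0.
Proof. by rewrite /sqn big1// => i _; rewrite mxE expr0n. Qed.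

Lemma enormE (x : rV) : enorm x = Num.sqrt (sqn x).
Proof. by []. Qed.

Lemma sqn_enorm (x : rV) : sqn x = enorm x ^+ 2.
Proof. by rewrite sqr_sqrtr// sqn_ge0. Qed.

Lemma enorm_gt0 (x : rV) : (0 < enorm x) = (x != 0).
Proof.
rewrite enormE sqrtr_gt0; apply/idP/idP; last exact: sqn_gt0.
by apply: contraTneq => ->; rewrite sqn0 ltxx.
Qed.

Definition qball (M : 'M[R]_n) : set rV := [set x | qform M x <= 1].

(** This 0-homogeneous function extends the power 2 q of the radial function of
the set where the form of M is at most 1. *)
Definition ratio_pow (M : 'M[R]_n) (q : R) (x : rV) : R := (sqn x / qform M x) `^ q.

Lemma measurable_sqn : measurable_fun [set: rV] (fun x => sqn x : measurableTypeR R).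
Proof. by under eq_fun do rewrite sqn_qform; exact: measurable_qform. Qed.

Lemma measurable_ratio_pow M q :
  measurable_fun [set: rV] (fun x => ratio_pow M q x : measurableTypeR R).
Proof.
apply: (measurableT_comp (measurable_powR _)); apply: measurable_funM.
  exact: measurable_sqn.
(* Measurability of the inverse comes from that of powR, which agrees with the
   inverse only on nonnegative arguments; hence the detour through the square. *)
rewrite (_ : (fun x => (qform M x)^-1 : measurableTypeR R) =
  (fun x => (qform M x) * (qform M x ^+ 2) `^ (-1))); last first.
  apply/funext => x; rewrite powR_inv1 ?sqr_ge0//.
  have [->|h] := eqVneq (qform M x) 0; first by rewrite invr0 mul0r.
  by rewrite expr2 invfM mulrA mulfV// mul1r.
apply: measurable_funM; first exact: measurable_qform.
apply: (measurableT_comp (measurable_powR _)); apply: measurable_funX.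
exact: measurable_qform.
Qed.

Lemma ratio_powZ M q r x : 0 < r -> ratio_pow M q (r *: x) = ratio_pow M q x.
Proof.
move=> r0; rewrite /ratio_pow sqn_qform qformZ qformZ -sqn_qform; congr (_ `^ _).
by rewrite -mulf_div divff ?mul1r// expf_neq0// gt_eqF.
Qed.

Lemma ratio_pow0 M q : q != 0 -> ratio_pow M q 0 = 0.
Proof. by move=> q0; rewrite /ratio_pow sqn0 mul0r powR0. Qed.

Lemma ratio_pow_ge0 M q x : 0 <= ratio_pow M q x.
Proof. exact: powR_ge0. Qed.

Lemma radial_qball M theta : 0 < qform M theta ->
  radial (qball M) theta = (Num.sqrt (qform M theta))^-1.
Proof.
set Q := qform M theta => Q0.
have s0 : 0 < Num.sqrt Q by rewrite sqrtr_gt0.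
rewrite /radial.
have -> : [set a | 0 <= a /\ qball M (a *: theta)] = `[0, (Num.sqrt Q)^-1]%classic.
  apply/seteqP; split=> a /=; rewrite in_itv/= /qball/= qformZ -/Q.
    move=> [a0 h]; rewrite a0/=.
    rewrite -(@ler_pM2r _ (Num.sqrt Q))// mulVf ?gt_eqF//.
    by rewrite -(@ler_pXn2r _ 2)// ?nnegrE ?mulr_ge0 ?(ltW s0)// exprMn sqr_sqrtr ?(ltW Q0)// expr1n.
  move=> /andP[a0 h]; split=> //.
  rewrite -(@ler_pM2r _ (Num.sqrt Q)) in h => //; rewrite mulVf ?gt_eqF// in h.
  have : (a * Num.sqrt Q) ^+ 2 <= 1 by rewrite expr_le1// mulr_ge0// (ltW s0).
  by rewrite exprMn sqr_sqrtr ?(ltW Q0).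
by rewrite sup_itvcc// invr_ge0 ltW.
Qed.

Lemma radial_powR M theta i : 0 < qform M theta -> sqn theta = 1 ->
  radial (qball M) theta `^ i = ratio_pow M (i / 2) theta.
Proof.
move=> Q0 N1; rewrite radial_qball// /ratio_pow N1 div1r.
rewrite -powR12_sqrt ?(ltW Q0)// -powRN.
rewrite (_ : (qform M theta)^-1 = qform M theta `^ (-1)); last by rewrite powR_inv1 ?ltW.
rewrite -!powRrM.
by congr (_ `^ _); field.
Qed.

(* Radial projection on the punctured unit ball, extended by 0, a point off the
   sphere: on subsets of the sphere, sphere_measure is then n times the image of
   Lebesgue measure. *)
Let dir (x : rV) : rV := if 0 < enorm x <= 1 then (enorm x)^-1 *: x else 0.

Let mD : measurable [set x : rV | 0 < enorm x <= 1].
Proof.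
rewrite (_ : [set x | _] = setT `&` (@enorm R n) @^-1` `]0, 1]).
  by apply: measurable_enorm.
by rewrite setTI; apply/seteqP; split => x /=; rewrite in_itv.
Qed.

Let mdir : measurable_fun [set: rV] dir.
Proof.
apply: measurable_fun_ifT => //.
  apply: (measurable_fun_bool true).
  by rewrite setTI.
apply: measurable_fun_coorP => i; under eq_fun do rewrite mxE.
apply: measurable_funM; last exact: measurable_coor.
under eq_fun do rewrite -powR_inv1 ?enorm_ge0//.
exact: measurableT_comp (measurable_powR _) (@measurable_enorm R n).
Qed.

Let push : {measure set rV -> \bar R} :=
  measure_function_pushforward__canonical__measure_function_Measure lam mdir.

Let measurable_sphere : measurable (@unit_sphere R n).
Proof.
rewrite (_ : @unit_sphere R n = setT `&` (@enorm R n) @^-1` [set 1]); last by rewrite setTI.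
by apply: measurable_enorm => //; exact: measurable_set1.
Qed.

(** Spherical measure is n times the image of Lebesgue measure on the punctured
unit ball under radial projection, and ratio_pow is constant along rays. *)
Lemma dual_volume_qball (M : 'M[R]_n) i : (0 < n)%N -> i != 0 -> posdef M ->
  dual_volume i (qball M) = (\int[lam]_x (ratio_pow M (i / 2) x * le1_ind (sqn x))%:E)%E.
Proof.
move=> n0 i0 pM; rewrite /dual_volume.
have q0 : i / 2 != 0 by rewrite mulf_neq0// invr_neq0.
pose n_nng : {nonneg R} := NngNum (ler0n R n).
have mr := @measurable_ratio_pow M (i / 2).
transitivity ((n%:R^-1)%:E * \int[mscale n_nng push]_(t in @unit_sphere R n) (ratio_pow M (i / 2) t)%:E)%E.
  congr (_ * _)%E.
  transitivity (\int[@sphere_measure R n]_(t in @unit_sphere R n) (ratio_pow M (i / 2) t)%:E)%E.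
    apply: eq_integral => t; rewrite inE => t1; congr EFin.
    have N1 : sqn t = 1 by rewrite sqn_enorm t1 expr1n.
    apply: radial_powR => //; apply: pM; rewrite -enorm_gt0 t1//.
  apply: eq_measure_integral => A mA AS.
  rewrite /= /sphere_measure /mscale /=; congr (_ * _)%E.
  rewrite sphere_coneE; congr (lam _).
  apply/seteqP; split=> x /=; rewrite /dir.
    by move=> [Ax ->].
  case: ifPn => [//|_ /AS]; rewrite /unit_sphere/= enormE sqn0 sqrtr0 => /eqP.
  by rewrite eq_sym oner_eq0.
rewrite ge0_integral_mscale//; last 2 first.
  by apply/measurable_EFinP; exact: measurable_funS mr.
  by move=> x _; rewrite lee_fin ratio_pow_ge0.
rewrite muleA -EFinM mulVf ?mul1e ?pnatr_eq0 -?lt0n//.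
rewrite (ge0_integral_pushforward mdir)//; last 2 first.
  by apply/measurable_EFinP; exact: measurable_funS mr.
  by move=> x _; rewrite lee_fin ratio_pow_ge0.
rewrite integral_mkcond; apply: eq_integral => x _.
rewrite patchE; have [/andP[x0 x1]|xD] := boolP (0 < enorm x <= 1).
  have xS : x \in dir @^-1` @unit_sphere R n.
    rewrite inE /= /dir x0 x1 /= /unit_sphere/= enormZ ?invr_ge0 ?enorm_ge0//.
    by rewrite mulVf// gt_eqF.
  rewrite xS /= /dir x0 x1 /= ratio_powZ ?invr_gt0// le1_indE sqn_enorm.
  by rewrite expr_le1// ?enorm_ge0// x1 mulr1.
rewrite memNset; last first.
  rewrite /= /dir (negbTE xD) /unit_sphere/= enormE sqn0 sqrtr0 => /eqP.
  by rewrite eq_sym oner_eq0.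
move: xD; rewrite negb_and enorm_gt0 negbK => /orP[/eqP ->|xD].
  by rewrite ratio_pow0// mul0r.
by rewrite le1_indE sqn_enorm expr_le1 ?enorm_ge0// (negbTE xD) mulr0.
Qed.
End sphere.

(** * Moments of the dual volumes *)

Section transform.
Context {R : realType} (n : nat).
Local Notation mu := (@lebesgue_measure R).
Local Notation lam := (@lebesgue_rV R n).
Local Notation rV := 'rV[R]_n.
Hypothesis n0 : (0 < n)%N.
Let p : R := n%:R / 2.
Let p0 : 0 < p. Proof. by rewrite divr_gt0// ltr0n. Qed.

Lemma sqnZ r (x : rV) : sqn (r *: x) = r ^+ 2 * sqn x.
Proof. by rewrite !sqn_qform qformZ. Qed.

(** The exchange identity with both forms equal to |x|^2: the dual volume
determines the integrals of ratio_pow against all radial weights psi. *)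
Lemma dual_volume_moment (M : 'M[R]_n) i (psi : R -> \bar R) : i != 0 -> posdef M ->
  measurable_fun [set: measurableTypeR R] psi -> (forall v, 0 <= psi v)%E ->
  (dual_volume i (qball M) * \int[mu]_u (psi (expR u) * (expR u `^ p)%:E) =
   (\int[lam]_x ((ratio_pow M (i / 2) x)%:E * psi (sqn x))) * (p^-1)%:E)%E.
Proof.
move=> i0 pM mpsi psi0.
have q0 : i / 2 != 0 by rewrite mulf_neq0// invr_neq0.
have msqn := @measurable_sqn R n.
have mrat := @measurable_ratio_pow R n M (i / 2).
rewrite dual_volume_qball//.
rewrite (@polar_exchange R n (ratio_pow M (i / 2)) (@sqn R n) (@sqn R n) le1_ind (fun v => psi v * (v `^ p)%:E)%E)//.
- rewrite integral_unit_ball_weight//; congr (_ * _)%E.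
  apply: eq_integral => x _.
  have [->|x0] := eqVneq x 0; first by rewrite ratio_pow0// !mul0r !mul0e.
  rewrite EFinM -muleA; congr (_ * _)%E.
  rewrite muleCA -EFinM -powRD ?addNr ?powRr0 ?mule1//.
  by rewrite (gt_eqF (sqn_gt0 x0)) implybT.
- exact: measurable_le1_ind.
- apply: emeasurable_funM => //; apply/measurable_EFinP; exact: measurable_powR.
- by move=> x; exact: ratio_pow_ge0.
- by move=> v; rewrite mule_ge0// lee_fin powR_ge0.
- exact: ratio_pow0.
- by move=> r x r0; exact: ratio_powZ.
- by move=> r x _; exact: sqnZ.
- by move=> r x _; exact: sqnZ.
- exact: sqn_gt0.
- exact: sqn_gt0.
Qed.

Let measurable_exp_qform (M : 'M[R]_n) :
  measurable_fun [set: rV] (fun x => expR (- qform M x) : measurableTypeR R).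
Proof.
apply: (measurableT_comp (f := expR)) => //.
by apply: measurableT_comp => //; exact: measurable_qform.
Qed.

(** In degree n the function (|x|^2 / Q)^(n/2) exactly compensates the change of
quadratic form in the exchange identity, so that the dual volume of order n
becomes a plain Gaussian integral. *)
Lemma dual_volume_gauss (M : 'M[R]_n) : posdef M ->
  (dual_volume n%:R (qball M) * \int[mu]_u (expR (- expR u) * expR u `^ p)%:E =
   (\int[lam]_x (expR (- qform M x))%:E) * (p^-1)%:E)%E.
Proof.
move=> pM.
have i0 : n%:R != 0 :> R by rewrite pnatr_eq0 -lt0n.
have msqn := @measurable_sqn R n.
have mQ := @measurable_qform R n M.
have mrat := @measurable_ratio_pow R n M p.
have mphi : measurable_fun [set: measurableTypeR R] (fun v : measurableTypeR R => expR (- v) * v `^ p : measurableTypeR R).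
  apply: measurable_funM; last exact: measurable_powR.
  by apply: (measurableT_comp (f := expR)).
rewrite dual_volume_qball// -/p.
rewrite (@polar_exchange R n (ratio_pow M p) (@sqn R n) (qform M) le1_ind
  (fun v => (expR (- v) * v `^ p)%:E)%E)//.
- rewrite integral_unit_ball_weight//; congr (_ * _)%E.
  apply: eq_integral_rV0 => //.
  + apply: emeasurable_funM.
      apply/measurable_EFinP; apply: measurable_funM => //.
      exact: (measurableT_comp (measurable_powR _)).
    by apply/measurable_EFinP; apply: (measurableT_comp mphi).
  + by apply/measurable_EFinP; exact: measurable_exp_qform.
  + move=> x; rewrite -EFinM lee_fin.
    apply: mulr_ge0; apply: mulr_ge0;
    by rewrite ?ratio_pow_ge0 ?expR_ge0 ?powR_ge0.
  + move=> x x0; rewrite -EFinM; congr EFin.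
    have N0 := sqn_gt0 x0; have Q0 := pM _ x0.
    rewrite mulrCA -[RHS]mulr1; congr (_ * _).
    have a1 : sqn x `^ p * sqn x `^ (- p) = 1.
      by rewrite -powRD ?(gt_eqF N0) ?implybT// subrr powRr0.
    have b1 : (qform M x)^-1 `^ p * qform M x `^ p = 1.
      by rewrite -powRM ?invr_ge0 ?(ltW Q0)// mulVf ?gt_eqF// powR1.
    rewrite /ratio_pow powRM ?invr_ge0 ?(ltW N0) ?(ltW Q0)//.
    transitivity ((sqn x `^ p * sqn x `^ (- p)) * ((qform M x)^-1 `^ p * qform M x `^ p)).
      by ring.
    by rewrite a1 b1 mulr1.
- exact: measurable_le1_ind.
- exact/measurable_EFinP.
- by move=> x; exact: ratio_pow_ge0.
- by move=> v; rewrite lee_fin mulr_ge0// ?expR_ge0// powR_ge0.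
- by apply: ratio_pow0; rewrite gt_eqF.
- by move=> r x r0; exact: ratio_powZ.
- by move=> r x _; exact: sqnZ.
- by move=> r x _; exact: qformZ.
- exact: sqn_gt0.
Qed.

Section kernel.
Variables (k : R -> R) (q : R).
Hypotheses (mk : measurable_fun [set: measurableTypeR R] (k : measurableTypeR R -> measurableTypeR R))
  (k0 : forall t, 0 <= k t) (q0 : q != 0).

Let mell (M : 'M[R]_n) : measurable_fun [set: rV * measurableTypeR R]
  (fun z : rV * measurableTypeR R =>
    expR z.2 `^ q * (expR (- sqn z.1) * k (expR z.2 * qform M z.1)) : measurableTypeR R).
Proof.
have me : measurable_fun [set: rV * measurableTypeR R]
    (fun z : rV * measurableTypeR R => expR z.2 : measurableTypeR R).
  by apply: (measurableT_comp (f := expR)).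
have mf : measurable_fun [set: rV * measurableTypeR R]
  (fun z : rV * measurableTypeR R => z.1) by exact: measurable_fst.
apply: measurable_funM; first by apply: (measurableT_comp (measurable_powR _)).
apply: measurable_funM.
  apply: (measurableT_comp (f := expR)) => //; apply: measurableT_comp => //.
  exact: (measurableT_comp (@measurable_sqn R n)).
apply: (measurableT_comp mk); apply: measurable_funM => //.
exact: (measurableT_comp (@measurable_qform R n M)).
Qed.

Lemma measurable_mellin : measurable_fun [set: measurableTypeR R]
  (fun v : measurableTypeR R => \int[mu]_u (expR u `^ q * k (expR u * v))%:E)%E.
Proof.
apply: (measurable_fun_fubini_tonelli_F
  (fun z : measurableTypeR R * measurableTypeR R => (expR z.2 `^ q * k (expR z.2 * z.1))%:E)).
  apply/measurable_EFinP.
  have me : measurable_fun [set: measurableTypeR R * measurableTypeR R]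
      (fun z : measurableTypeR R * measurableTypeR R => expR z.2 : measurableTypeR R).
    by apply: (measurableT_comp (f := expR)).
  apply: measurable_funM; first by apply: (measurableT_comp (measurable_powR _)).
  by apply: (measurableT_comp mk); apply: measurable_funM.
by move=> z; rewrite lee_fin mulr_ge0// powR_ge0.
Qed.

(** Replacing s by s Q (x) / |x|^2 in the inner integral produces the factor
(Q / |x|^2)^q, which cancels ratio_pow. *)
Lemma ratio_pow_kernel (M : 'M[R]_n) : posdef M ->
  (\int[lam]_x ((ratio_pow M q x)%:E * ((expR (- sqn x))%:E *
      \int[mu]_u (expR u `^ q * k (expR u * sqn x))%:E)) =
   \int[mu]_u \int[lam]_x (expR u `^ q * (expR (- sqn x) * k (expR u * qform M x)))%:E)%E.
Proof.
move=> pM.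
have msqn := @measurable_sqn R n.
have mrat := @measurable_ratio_pow R n M q.
have F0 (z : rV * measurableTypeR R) :
    (0 <= (expR z.2 `^ q * (expR (- sqn z.1) * k (expR z.2 * qform M z.1)))%:E)%E.
  by rewrite lee_fin mulr_ge0 ?powR_ge0// mulr_ge0// expR_ge0.
rewrite -(fubini_tonelli (fun z : rV * measurableTypeR R =>
  (expR z.2 `^ q * (expR (- sqn z.1) * k (expR z.2 * qform M z.1)))%:E)) //; last first.
  by apply/measurable_EFinP; exact: mell.
have mI : measurable_fun [set: rV] (fun x : rV => expR (- sqn x) : measurableTypeR R).
  by apply: (measurableT_comp (f := expR)) => //; apply: measurableT_comp.
apply: eq_integral_rV0 => //.
- apply: emeasurable_funM; first exact/measurable_EFinP.
  apply: emeasurable_funM; first exact/measurable_EFinP.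
  exact: (measurableT_comp measurable_mellin).
- apply: (measurable_fun_fubini_tonelli_F (fun z : rV * measurableTypeR R =>
  (expR z.2 `^ q * (expR (- sqn z.1) * k (expR z.2 * qform M z.1)))%:E)) => //.
  by apply/measurable_EFinP; exact: mell.
- move=> x; apply: mule_ge0; first by rewrite lee_fin ratio_pow_ge0.
  apply: mule_ge0; first by rewrite lee_fin expR_ge0.
  by apply: integral_ge0 => u _; rewrite lee_fin mulr_ge0// powR_ge0.
- by move=> x; apply: integral_ge0 => u _; exact: (F0 (x, u)).
move=> x x0.
have N0 := sqn_gt0 x0; have Q0 := pM _ x0.
have c0 : 0 < qform M x / sqn x by rewrite divr_gt0.
pose f v := (v `^ q * k (v * sqn x))%:E.
have mf : measurable_fun [set: measurableTypeR R] f.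
  apply/measurable_EFinP; apply: measurable_funM; first exact: measurable_powR.
  by apply: (measurableT_comp mk); apply: measurable_funM.
rewrite -(haarZ c0 mf); last by move=> v; rewrite lee_fin mulr_ge0// powR_ge0.
have mku : measurable_fun [set: measurableTypeR R]
    (fun u : measurableTypeR R => f (qform M x / sqn x * expR u)).
  by apply: (measurableT_comp mf); apply: measurable_funM.
have f0 v : (0 <= f v)%E by rewrite lee_fin mulr_ge0// powR_ge0.
rewrite muleA -EFinM -ge0_integralZl//; last by rewrite lee_fin mulr_ge0 ?ratio_pow_ge0 ?expR_ge0.
apply: eq_integral => u _; rewrite -EFinM; congr EFin.
rewrite powRM ?expR_ge0 ?(ltW c0)//.
have -> : qform M x / sqn x * expR u * sqn x = expR u * qform M x.
  by rewrite mulrAC divfK ?gt_eqF// mulrC.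
have e : ratio_pow M q x * (qform M x / sqn x) `^ q = 1.
  rewrite /ratio_pow -powRM ?divr_ge0 ?(ltW N0) ?(ltW Q0)//.
  by rewrite mulf_div [X in _ / X]mulrC divff ?powR1// mulf_neq0// gt_eqF.
move: e; set a := ratio_pow M q x; set b := (_ / _) `^ q => e.
by rewrite -[RHS]mul1r -e; ring.
Qed.
End kernel.

End transform.

(** * The pencil of an ellipsoid *)

Section spectral.
Context {R : realType} (n : nat).
Local Notation mu := (@lebesgue_measure R).
Local Notation lam := (@lebesgue_rV R n).
Implicit Types (x : 'rV[R]_n) (U : 'M[R]_n).

Definition ell_mx x U : 'M[R]_n := U^T *m diag_mx x *m U.

(** The determinant of 1 + s M, where M is the matrix with eigenvalues x. *)
Definition pencil x s : R := \prod_k (1 + s * x 0 k).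

Lemma qform_ell x U y : qform (ell_mx x U) y = \sum_k x 0 k * (y *m U^T) 0 k ^+ 2.
Proof.
rewrite /qform /ell_mx !mulmxA -mulmxA.
have -> : U *m y^T = (y *m U^T)^T by rewrite trmx_mul trmxK.
set z := y *m U^T.
rewrite mul_mx_diag mxE; apply: eq_bigr => k _; rewrite !mxE; ring.
Qed.

Section orth.
Variables (x : 'rV[R]_n) (U : 'M[R]_n).
Hypotheses (x0 : forall k, 0 < x 0 k) (UU : U *m U^T = 1%:M).

Let UtU : U^T *m U = 1%:M. Proof. exact: mulmx1C. Qed.

Lemma trmx_ell : (ell_mx x U)^T = ell_mx x U.
Proof. by rewrite /ell_mx !trmx_mul trmxK tr_diag_mx mulmxA. Qed.

Lemma det_ell : \det (ell_mx x U) = \prod_k x 0 k.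
Proof.
rewrite /ell_mx !det_mulmx det_diag mulrAC -det_mulmx UtU det1 mul1r//.
Qed.

Lemma posdef_ell : posdef (ell_mx x U).
Proof.
move=> y y0; rewrite qform_ell.
have : 0 < sqn (y *m U^T).
  apply: sqn_gt0; apply: contraNN y0 => /eqP h.
  by rewrite -(mulmx1 y) -UtU mulmxA h mul0mx.
move=> z0; rewrite lt_neqAle sumr_ge0 ?andbT; last first.
  by move=> k _; rewrite mulr_ge0 ?sqr_ge0 ?ltW.
apply: contraTneq z0 => /esym/eqP; rewrite psumr_eq0; last first.
  by move=> k _; rewrite mulr_ge0 ?sqr_ge0 ?ltW.
move=> /allP h; rewrite -leNgt /sqn big1// => k _; apply/eqP.
have := h k; rewrite mem_index_enum => /(_ isT).
by rewrite /= mulf_eq0 gt_eqF.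
Qed.

Lemma add_ellE s : 1%:M + s *: ell_mx x U = ell_mx (\row_k (1 + s * x 0 k)) U.
Proof.
rewrite /ell_mx -{1}UtU -{1}(mulmx1 U^T) scalemxAl scalemxAr -mulmxDl -mulmxDr.
congr (_ *m _ *m _); apply/matrixP => i j; rewrite !mxE.
by case: eqP => [->|_]; rewrite ?mulr1n// !mulr0n mulr0 addr0.
Qed.
End orth.

Lemma pencil_gt0 x s : (forall k, 0 < x 0 k) -> 0 <= s -> 0 < pencil x s.
Proof.
by move=> x0 s0; apply: prodr_gt0 => k _; rewrite ltr_wpDr// mulr_ge0// ltW.
Qed.

Lemma pencil_ge1 x s : (forall k, 0 < x 0 k) -> 0 <= s -> 1 <= pencil x s.
Proof.
move=> x0 s0; rewrite /pencil; elim/big_ind: _ => // [a b a1 b1|k _].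
  by rewrite -[1]mulr1 ler_pM.
by rewrite lerDl mulr_ge0// ltW.
Qed.

Definition rsqrt_pencil x s : R := (Num.sqrt (pencil x s))^-1.

Lemma qform_add1 (M : 'M[R]_n) s y : qform (1%:M + s *: M) y = sqn y + s * qform M y.
Proof.
by rewrite sqn_qform /qform mulmxDr mulmxDl -scalemxAr -scalemxAl !mxE.
Qed.

Section gauss_ell.
Variables (x : 'rV[R]_n) (U : 'M[R]_n).
Hypotheses (x0 : forall k, 0 < x 0 k) (UU : U *m U^T = 1%:M).
Local Notation M := (ell_mx x U).

Lemma gauss_ell : (\int[lam]_y (expR (- qform M y))%:E =
  (@gauss_const R ^+ n / Num.sqrt (\prod_k x 0 k))%:E)%E.
Proof.
have [_ ->] := posdef_det_gauss (@trmx_ell x U) (posdef_ell x0 UU).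
by rewrite det_ell.
Qed.

Lemma gauss_ell_add s : 0 <= s ->
  (\int[lam]_y (expR (- (sqn y + s * qform M y)))%:E = (@gauss_const R ^+ n * rsqrt_pencil x s)%:E)%E.
Proof.
move=> s0.
have rp : forall k, 0 < (\row_k (1 + s * x 0 k)) 0 k.
  by move=> k; rewrite mxE ltr_wpDr// mulr_ge0// ltW.
have [_] := posdef_det_gauss (@trmx_ell (\row_k (1 + s * x 0 k)) U) (posdef_ell rp UU).
rewrite det_ell// (_ : \prod_k _ = pencil x s); last by apply: eq_bigr => k _; rewrite mxE.
move=> <-; apply: eq_integral => y _.
by rewrite -add_ellE// qform_add1.
Qed.

(** The absolute value only serves to make the kernel nonnegative for all
arguments; it is harmless since the form takes nonnegative values. *)
Lemma gauss_ell_sub s : 0 <= s ->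
  (\int[lam]_y (expR (- sqn y) * `|1 - expR (- (s * qform M y))|)%:E =
   (@gauss_const R ^+ n * (1 - rsqrt_pencil x s))%:E)%E.
Proof.
move=> s0.
have Q0 y : 0 <= qform M y.
  have [->|/posdef_ell h] := eqVneq y 0; last exact/ltW/h.
  by rewrite /qform !mul0mx mxE.
have mQ := @measurable_qform R n M.
have mN := @measurable_sqn R n.
have m1 : measurable_fun setT (fun y : 'rV[R]_n => expR (- sqn y) * `|1 - expR (- (s * qform M y))| : measurableTypeR R).
  apply: measurable_funM.
    by apply: (measurableT_comp (f := expR)) => //; apply: measurableT_comp.
  apply: measurableT_comp => //; apply: measurable_funB => //.
  apply: (measurableT_comp (f := expR)) => //; apply: measurableT_comp => //.
  exact: measurable_funM.
have m2 : measurable_fun setT (fun y : 'rV[R]_n => expR (- (sqn y + s * qform M y)) : measurableTypeR R).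
  apply: (measurableT_comp (f := expR)) => //; apply: measurableT_comp => //.
  by apply: measurable_funD => //; exact: measurable_funM.
have S : (\int[lam]_y (expR (- sqn y) * `|1 - expR (- (s * qform M y))|)%:E +
   \int[lam]_y (expR (- (sqn y + s * qform M y)))%:E = (@gauss_const R ^+ n * rsqrt_pencil x 0)%:E)%E.
  rewrite -ge0_integralD//; last 2 first.
  - exact/measurable_EFinP.
  - exact/measurable_EFinP.
  rewrite -gauss_ell_add//; apply: eq_integral => y _; rewrite -EFinD; congr EFin.
  rewrite ger0_norm; last first.
    by rewrite subr_ge0 -expR0 ler_expR oppr_le0 mulr_ge0.
  by rewrite mulrBr mulr1 -expRD -opprD subrK mul0r addr0.
rewrite gauss_ell_add// in S.
have F0 : rsqrt_pencil x 0 = 1.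
  by rewrite /rsqrt_pencil /pencil big1 ?sqrtr1 ?invr1// => k _; rewrite mul0r addr0.
rewrite F0 mulr1 in S.
rewrite -[LHS](@addeK R (@gauss_const R ^+ n * rsqrt_pencil x s)%:E)//.
by rewrite S -EFinB mulrBr mulr1.
Qed.
End gauss_ell.
End spectral.

(** * Mellin moments of the pencil determined by a dual volume *)

Section moments.
Context {R : realType} (n : nat).
Local Notation mu := (@lebesgue_measure R).
Local Notation lam := (@lebesgue_rV R n).
Implicit Types (x : 'rV[R]_n) (U : 'M[R]_n).

Lemma ellipsoidP (E : set 'rV[R]_n) : ellipsoid E ->
  exists x U, [/\ forall k, 0 < x 0 k, U *m U^T = 1%:M & E = qball (ell_mx x U)].
Proof.
move=> [a [U [a0 UU ->]]].
have UtU : U^T *m U = 1%:M by exact: mulmx1C.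
exists (\row_k (a k ^+ 2)^-1), U; split=> //.
  by move=> k; rewrite mxE invr_gt0 exprn_gt0.
apply/seteqP; split=> y /=.
  move=> [z zle <-]; rewrite /qball/= qform_ell -mulmxA UU mulmx1.
  by apply: le_trans zle; apply: ler_sum => k _; rewrite mxE mulrC.
rewrite /qball/= qform_ell => h; exists (y *m U^T).
  by apply: le_trans h; apply: ler_sum => k _; rewrite mxE mulrC.
by rewrite -mulmxA UtU mulmx1.
Qed.

Lemma gauss_const_gt0 : 0 < @gauss_const R.
Proof. by rewrite sqrtr_gt0 pi_gt0. Qed.

Lemma gauss_constX_gt0 : 0 < @gauss_const R ^+ n.
Proof. by rewrite exprn_gt0// gauss_const_gt0. Qed.

Lemma gauss_constX_ge0 : 0 <= @gauss_const R ^+ n.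
Proof. exact/ltW/gauss_constX_gt0. Qed.

Lemma measurable_exp_sqn :
  measurable_fun [set: 'rV[R]_n] (fun y => expR (- sqn y) : measurableTypeR R).
Proof.
have mN := @measurable_sqn R n.
by apply: (measurableT_comp (f := expR)) => //; apply: measurableT_comp.
Qed.

Lemma measurable_rsqrt_pencil x : (forall k, 0 < x 0 k) ->
  measurable_fun [set: measurableTypeR R]
    (fun u : measurableTypeR R => rsqrt_pencil x (expR u) : measurableTypeR R).
Proof.
move=> x0.
rewrite (_ : (fun u : measurableTypeR R => _) = (fun u => pencil x (expR u) `^ (- 2^-1))).
  apply: (measurableT_comp (measurable_powR _)); apply: measurable_prod => k _.
  apply: measurable_funD => //; apply: measurable_funM => //.
apply/funext => u; rewrite /rsqrt_pencil powRN powR12_sqrt//.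
by apply/ltW/pencil_gt0 => //; exact: expR_ge0.
Qed.

Hypothesis n0 : (0 < n)%N.
Let p0 : 0 < n%:R / 2 :> R. Proof. by rewrite divr_gt0// ltr0n. Qed.

Let cancel_c (a b : \bar R) (c : R) : 0 < c -> (a * c%:E = b * c%:E)%E -> a = b.
Proof.
move=> c0 /(congr1 (fun z => z * (c^-1)%:E)%E).
by rewrite -!muleA -EFinM mulfV ?gt_eqF// !mule1.
Qed.

Variables (x1 x2 : 'rV[R]_n) (U1 U2 : 'M[R]_n).
Hypotheses (x10 : forall k, 0 < x1 0 k) (x20 : forall k, 0 < x2 0 k)
  (UU1 : U1 *m U1^T = 1%:M) (UU2 : U2 *m U2^T = 1%:M).

(** For any kernel k whose Gaussian averages are known, equal dual volumes give
equal moments of these averages: the constants relating them depend only on the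
dimension, the order and k. *)
Lemma dual_volume_kernel_eq (k K1 K2 : R -> R) (i : R) : i != 0 ->
  measurable_fun [set: measurableTypeR R] (k : measurableTypeR R -> measurableTypeR R) ->
  (forall t, 0 <= k t) ->
  (forall s, 0 < s -> 0 <= K1 s) -> (forall s, 0 < s -> 0 <= K2 s) ->
  measurable_fun [set: measurableTypeR R] (fun u : measurableTypeR R => K1 (expR u) : measurableTypeR R) ->
  measurable_fun [set: measurableTypeR R] (fun u : measurableTypeR R => K2 (expR u) : measurableTypeR R) ->
  (forall s, 0 < s -> (\int[lam]_y (expR (- sqn y) * k (s * qform (ell_mx x1 U1) y))%:E =
     (@gauss_const R ^+ n * K1 s)%:E)%E) ->
  (forall s, 0 < s -> (\int[lam]_y (expR (- sqn y) * k (s * qform (ell_mx x2 U2) y))%:E =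
     (@gauss_const R ^+ n * K2 s)%:E)%E) ->
  dual_volume i (qball (ell_mx x1 U1)) = dual_volume i (qball (ell_mx x2 U2)) ->
  (\int[mu]_u (expR u `^ (i / 2) * K1 (expR u))%:E =
   \int[mu]_u (expR u `^ (i / 2) * K2 (expR u))%:E)%E.
Proof.
move=> i0 mk k0 K10 K20 mK1 mK2 I1 I2 V12.
have q0 : i / 2 != 0 by rewrite mulf_neq0// invr_neq0.
(* The radial weight for which ratio_pow_kernel applies. *)
pose psi v := ((expR (- v))%:E *
   \int[mu]_u (expR u `^ (i / 2) * k (expR u * v))%:E)%E.
have mpsi : measurable_fun [set: measurableTypeR R] psi.
  apply: emeasurable_funM; last exact: measurable_mellin.
  by apply/measurable_EFinP; apply: (measurableT_comp (f := expR)).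
have psi0 v : (0 <= psi v)%E.
  apply: mule_ge0; first by rewrite lee_fin expR_ge0.
  by apply: integral_ge0 => u _; rewrite lee_fin mulr_ge0// powR_ge0.
have h2 := dual_volume_moment n0 i0 (posdef_ell x20 UU2) mpsi psi0.
have h1 := dual_volume_moment n0 i0 (posdef_ell x10 UU1) mpsi psi0.
rewrite -V12 in h2.
have pV : 0 < (n%:R / 2)^-1 :> R by rewrite invr_gt0.
have h12 := cancel_c pV (etrans (esym h1) h2).
have e1 := ratio_pow_kernel n0 (i / 2) mk k0 (posdef_ell x10 UU1).
have e2 := ratio_pow_kernel n0 (i / 2) mk k0 (posdef_ell x20 UU2).
have {e1 e2 h1 h2}h := etrans (esym e1) (etrans h12 e2).
have step x U K : (forall k, 0 < x 0 k) -> U *m U^T = 1%:M ->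
    (forall s, 0 < s -> 0 <= K s) ->
    measurable_fun [set: measurableTypeR R] (fun u : measurableTypeR R => K (expR u) : measurableTypeR R) ->
    (forall s, 0 < s -> (\int[lam]_y (expR (- sqn y) * k (s * qform (ell_mx x U) y))%:E =
     (@gauss_const R ^+ n * K s)%:E)%E) ->
    (\int[mu]_u \int[lam]_y (expR u `^ (i / 2) *
       (expR (- sqn y) * k (expR u * qform (ell_mx x U) y)))%:E =
     (\int[mu]_u (expR u `^ (i / 2) * K (expR u))%:E) * (@gauss_const R ^+ n)%:E)%E.
  move=> x0 UU K0 mK I.
  rewrite -[RHS]ge0_integralZr; [|exact: measurableT|..]; last 3 first.
  - apply/measurable_EFinP; apply: measurable_funM; last exact: mK.
    by apply: (measurableT_comp (measurable_powR _)).
  - move=> u _; rewrite lee_fin; apply: mulr_ge0; first exact: powR_ge0.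
    by apply: K0; exact: expR_gt0.
  - rewrite lee_fin; exact: gauss_constX_ge0.
  apply: eq_integral => u _.
  transitivity ((expR u `^ (i / 2))%:E * (@gauss_const R ^+ n * K (expR u))%:E)%E; last first.
    by rewrite -EFinM -EFinM -mulrA (mulrC (K (expR u))).
  rewrite -(I (expR u) (expR_gt0 u)).
  rewrite -[RHS]ge0_integralZl; [|exact: measurableT|..]; last 3 first.
  - apply/measurable_EFinP; apply: measurable_funM.
      exact: measurable_exp_sqn.
    apply: (measurableT_comp mk); apply: measurable_funM; first exact: measurable_cst.
    exact: measurable_qform.
  - by move=> y _; rewrite lee_fin; apply: mulr_ge0 => //; exact: expR_ge0.
  - by rewrite lee_fin powR_ge0.
  by [].
have s1 := step _ _ _ x10 UU1 K10 mK1 I1.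
have s2 := step _ _ _ x20 UU2 K20 mK2 I2.
exact: (cancel_c gauss_constX_gt0 (etrans (esym s1) (etrans h s2))).
Qed.

Lemma rsqrt_pencil_ge0 x s : 0 <= rsqrt_pencil x s.
Proof. by rewrite invr_ge0 sqrtr_ge0. Qed.

Lemma rsqrt_pencil_le1 x s : (forall k, 0 < x 0 k) -> 0 <= s -> rsqrt_pencil x s <= 1.
Proof.
move=> x0 s0; rewrite /rsqrt_pencil invf_le1 ?sqrtr_gt0 ?pencil_gt0//.
by rewrite -[1]sqrtr1 ler_wsqrtr// pencil_ge1.
Qed.

Lemma moment_pos i : 0 < i ->
  dual_volume i (qball (ell_mx x1 U1)) = dual_volume i (qball (ell_mx x2 U2)) ->
  (\int[mu]_u (expR u `^ (i / 2) * rsqrt_pencil x1 (expR u))%:E =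
   \int[mu]_u (expR u `^ (i / 2) * rsqrt_pencil x2 (expR u))%:E)%E.
Proof.
move=> i0; apply: (@dual_volume_kernel_eq (fun t => expR (- t))).
- by rewrite gt_eqF.
- by apply: (measurableT_comp (f := expR)).
- by move=> t; exact: expR_ge0.
- by move=> s _; exact: rsqrt_pencil_ge0.
- by move=> s _; exact: rsqrt_pencil_ge0.
- exact: measurable_rsqrt_pencil.
- exact: measurable_rsqrt_pencil.
- move=> s s0; rewrite -(gauss_ell_add x10 UU1 (ltW s0)).
  by apply: eq_integral => y _; rewrite opprD expRD.
- move=> s s0; rewrite -(gauss_ell_add x20 UU2 (ltW s0)).
  by apply: eq_integral => y _; rewrite opprD expRD.
Qed.

Lemma moment_neg i : i < 0 ->
  dual_volume i (qball (ell_mx x1 U1)) = dual_volume i (qball (ell_mx x2 U2)) ->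
  (\int[mu]_u (expR u `^ (i / 2) * (1 - rsqrt_pencil x1 (expR u)))%:E =
   \int[mu]_u (expR u `^ (i / 2) * (1 - rsqrt_pencil x2 (expR u)))%:E)%E.
Proof.
move=> i0; apply: (@dual_volume_kernel_eq (fun t => `|1 - expR (- t)|)
  (fun s => 1 - rsqrt_pencil x1 s) (fun s => 1 - rsqrt_pencil x2 s)).
- by rewrite lt_eqF.
- apply: measurableT_comp => //; apply: measurable_funB => //.
  by apply: (measurableT_comp (f := expR)).
- by [].
- by move=> s s0; rewrite subr_ge0 rsqrt_pencil_le1// ltW.
- by move=> s s0; rewrite subr_ge0 rsqrt_pencil_le1// ltW.
- by apply: measurable_funB => //; exact: measurable_rsqrt_pencil.
- by apply: measurable_funB => //; exact: measurable_rsqrt_pencil.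
- by move=> s s0; rewrite gauss_ell_sub// ltW.
- by move=> s s0; rewrite gauss_ell_sub// ltW.
Qed.

Lemma moment_dim :
  dual_volume n%:R (qball (ell_mx x1 U1)) = dual_volume n%:R (qball (ell_mx x2 U2)) ->
  \prod_k x1 0 k = \prod_k x2 0 k.
Proof.
move=> V12.
have h2 := dual_volume_gauss n0 (posdef_ell x20 UU2).
have h1 := dual_volume_gauss n0 (posdef_ell x10 UU1).
rewrite -V12 in h2.
have pV : 0 < (n%:R / 2)^-1 :> R by rewrite invr_gt0.
have h12 := cancel_c pV (etrans (esym h1) h2).
have h := EFin_inj (etrans (esym (gauss_ell x10 UU1)) (etrans h12 (gauss_ell x20 UU2))).
have d1 : 0 < \prod_k x1 0 k by exact: prodr_gt0.
have d2 : 0 < \prod_k x2 0 k by exact: prodr_gt0.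
have g0 : (@gauss_const R ^+ n) != 0 by rewrite (gt_eqF gauss_constX_gt0).
have /(congr1 (fun z => z ^+ 2)) := invr_inj (mulfI g0 h).
by rewrite (sqr_sqrtr (ltW d1)) (sqr_sqrtr (ltW d2)).
Qed.

End moments.

(** * Integrability of the moments *)

Section integrability.
Context {R : realType}.
Local Notation mu := (@lebesgue_measure R).

Lemma powR_expR (u q : R) : expR u `^ q = expR (q * u).
Proof. by rewrite /powR gt_eqF ?expR_gt0// expRK. Qed.

(** Up to a constant this is the sum of an exponential density and its mirror
image. *)
Lemma integrable_exp_abs (d : R) : 0 < d ->
  mu.-integrable [set: measurableTypeR R] (fun u => (expR (- (d * `|u|)))%:E).
Proof.
move=> d0.
have mpdf : measurable_fun [set: measurableTypeR R]
    (fun u : measurableTypeR R => (exponential_pdf d u)%:E).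
  by apply/measurable_EFinP; exact: measurable_exponential_pdf.
have pdf0 u : 0 <= exponential_pdf d u by apply: exponential_pdf_ge0; exact: ltW.
have mopp : measurable_fun [set: measurableTypeR R]
    (-%R : measurableTypeR R -> measurableTypeR R) by exact: oppr_measurable.
have i2 : (\int[mu]_u (exponential_pdf d (- u))%:E = 1)%E.
  rewrite -(integral_exponential_pdf d0).
  rewrite [RHS](eq_measure_integral (pushforward mu (-%R : measurableTypeR R -> measurableTypeR R))).
    by rewrite (ge0_integral_pushforward mopp)// => u _; rewrite lee_fin.
  by move=> A mA _; apply: esym; exact: lebesgue_measureN.
apply/integrableP; split.
  apply/measurable_EFinP; apply: (measurableT_comp (f := expR)) => //.
  by apply: measurableT_comp => //; apply: measurable_funM => //; exact: measurableT_comp.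
apply: (@le_lt_trans _ _ (\int[mu]_u ((d^-1)%:E * ((exponential_pdf d u)%:E + (exponential_pdf d (- u))%:E)))%E).
  apply: ge0_le_integral => //.
  - apply/measurable_EFinP; apply: measurableT_comp => //.
    apply: (measurableT_comp (f := expR)) => //.
    by apply: measurableT_comp => //; apply: measurable_funM => //; exact: measurableT_comp.
  - apply: emeasurable_funM => //; apply: emeasurable_funD => //.
    exact: (measurableT_comp mpdf).
  - move=> u _; rewrite /= ger0_norm ?expR_ge0// -EFinD -EFinM lee_fin.
    have [u0|u0] := leP 0 u.
      rewrite (exponential_pdfE d u0) ger0_norm// mulrDr mulrA mulVf ?gt_eqF// mul1r mulNr lerDl.
      by rewrite mulr_ge0 ?invr_ge0 ?(ltW d0).
    rewrite (@exponential_pdfE _ d (- u)) ?oppr_ge0 ?(ltW u0)// ltr0_norm//.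
    rewrite mulrDr [X in _ + X]mulrA mulVf ?gt_eqF// mul1r mulNr lerDr.
    by rewrite mulr_ge0 ?invr_ge0 ?(ltW d0).
rewrite ge0_integralZl; [|exact: measurableT|..]; last 3 first.
- apply: emeasurable_funD => //; exact: (measurableT_comp mpdf).
- by move=> u _; rewrite adde_ge0// lee_fin.
- by rewrite lee_fin invr_ge0 ltW.
rewrite ge0_integralD; [|exact: measurableT|..]; last 4 first.
- by move=> u _; rewrite lee_fin.
- exact: mpdf.
- by move=> u _; rewrite lee_fin.
- exact: (measurableT_comp mpdf).
by rewrite i2 integral_exponential_pdf// -EFinD -EFinM ltry.
Qed.

Lemma integrable_exp_decay (f : R -> R) (C d : R) : 0 < d ->
  measurable_fun [set: measurableTypeR R] (f : measurableTypeR R -> measurableTypeR R) ->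
  (forall u, `|f u| <= C * expR (- (d * `|u|))) ->
  mu.-integrable [set: measurableTypeR R] (EFin \o f).
Proof.
move=> d0 mf fC.
have := integrableZl measurableT C (integrable_exp_abs d0).
apply: le_integrable => //; first exact/measurable_EFinP.
move=> u _ /=; rewrite lee_fin; apply: le_trans (fC u) _.
exact: ler_norm.
Qed.
End integrability.

Section decay.
Context {R : realType} (n : nat) (x : 'rV[R]_n).
Local Notation mu := (@lebesgue_measure R).
Hypotheses (n0 : (0 < n)%N) (x0 : forall k, 0 < x 0 k).

Lemma pencil_ge_lead s : 0 <= s -> s ^+ n * \prod_k x 0 k <= pencil x s.
Proof.
move=> s0; rewrite -[X in _ ^+ X]card_ord -prodr_const -big_split /=.
apply: ler_prod => k _; rewrite mulr_ge0//=; last exact: ltW.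
by rewrite lerDr.
Qed.

(** The polynomial has nonnegative coefficients and value 1 at 0, so that its
increments are at most linear on [0, 1]. *)
Lemma pencil_le_linear s : 0 <= s <= 1 -> pencil x s <= 1 + s * (pencil x 1 - 1).
Proof.
move=> /andP[s0 s1]; rewrite /pencil.
have : 1 <= \prod_k (1 + 1 * x 0 k) /\
   \prod_k (1 + s * x 0 k) <= 1 + s * (\prod_k (1 + 1 * x 0 k) - 1).
  elim/big_rec2: _ => [|k Q P _ [P1 QP]]; first by rewrite subrr mulr0 addr0.
  have := x0 k; set y := x 0 k => y0.
  split; first by nra.
  have : (1 + s * y) * Q <= (1 + s * y) * (1 + s * (P - 1)).
    by apply: ler_wpM2l => //; nra.
  move/le_trans; apply.
  have : s * (s * (y * (P - 1))) <= 1 * (s * (y * (P - 1))).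
    apply: ler_wpM2r => //; apply: mulr_ge0 => //; apply: mulr_ge0; first exact: ltW.
    by rewrite subr_ge0.
  nra.
by move=> [].
Qed.

(** For s <= 1 the factor s^q decays, since p >= 1; for s >= 1 the leading term
of p, of order s^n, gives s^(q - n/2). *)
Lemma rsqrt_pencil_decay q u : 0 < q < n%:R / 2 ->
  `|expR (q * u) * rsqrt_pencil x (expR u)| <=
   (1 + (Num.sqrt (\prod_k x 0 k))^-1) * expR (- (Num.min q (n%:R / 2 - q) * `|u|)).
Proof.
move=> /andP[q0 qn].
set P := \prod_k x 0 k.
have P0 : 0 < P by exact: prodr_gt0.
have sP0 : 0 < Num.sqrt P by rewrite sqrtr_gt0.
rewrite ger0_norm ?mulr_ge0 ?expR_ge0 ?rsqrt_pencil_ge0//.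
set d := Num.min _ _.
have dq : d <= q by rewrite /d ge_min lexx.
have dn : d <= n%:R / 2 - q by rewrite /d ge_min lexx orbT.
have [u0|u0] := leP 0 u; last first.
  apply: (@le_trans _ _ (1 * expR (- (d * `|u|)))).
    rewrite mulrC ler_pM ?rsqrt_pencil_ge0 ?expR_ge0 ?rsqrt_pencil_le1 ?expR_ge0//.
    by rewrite ler_expR ltr0_norm//; nra.
  by rewrite ler_pM2r ?expR_gt0// lerDl invr_ge0 ltW.
apply: (@le_trans _ _ ((Num.sqrt P)^-1 * expR (- (d * `|u|)))); last first.
  by rewrite ler_pM2r ?expR_gt0// lerDr.
have F_le : rsqrt_pencil x (expR u) <= (Num.sqrt P)^-1 * expR (- (n%:R / 2 * u)).
  have -> : expR (- (n%:R / 2 * u)) = (Num.sqrt (expR u ^+ n))^-1.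
    rewrite expRN; congr (_^-1); apply/eqP.
    rewrite -(@eqrXn2 _ 2)// ?expR_ge0 ?sqrtr_ge0// sqr_sqrtr ?exprn_ge0 ?expR_ge0//.
    by rewrite -!expRM_natl; apply/eqP; congr expR; field.
  rewrite -invfM -sqrtrM ?(ltW P0)// /rsqrt_pencil lef_pV2 ?posrE ?sqrtr_gt0 ?pencil_gt0 ?expR_ge0//; last first.
    by rewrite mulr_gt0// exprn_gt0// expR_gt0.
  by rewrite ler_wsqrtr// mulrC pencil_ge_lead// expR_ge0.
apply: (@le_trans _ _ (expR (q * u) * ((Num.sqrt P)^-1 * expR (- (n%:R / 2 * u))))).
  by rewrite ler_pM2l ?expR_gt0.
rewrite mulrCA -expRD ler_pM2l ?invr_gt0// ler_expR ger0_norm//; nra.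
Qed.

(** For s >= 1 the factor s^q decays; for s <= 1 the difference
1 - p^(-1/2) is O (s), which gives s^(q + 1). *)
Lemma sub1_rsqrt_pencil_decay q u : -1 < q < 0 ->
  `|expR (q * u) * (1 - rsqrt_pencil x (expR u))| <=
   pencil x 1 * expR (- (Num.min (- q) (1 + q) * `|u|)).
Proof.
move=> /andP[q1 q0].
have den1 := pencil_ge1 x0 (@ler01 R).
have F1 : 0 <= 1 - rsqrt_pencil x (expR u) by rewrite subr_ge0 rsqrt_pencil_le1// expR_ge0.
rewrite ger0_norm ?mulr_ge0 ?expR_ge0//.
set d := Num.min _ _.
have dq : d <= - q by rewrite /d ge_min lexx.
have dn : d <= 1 + q by rewrite /d ge_min lexx orbT.
have [u0|u0] := leP 0 u.
  rewrite mulrC ler_pM ?expR_ge0//.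
    by apply: le_trans den1; rewrite gerBl rsqrt_pencil_ge0.
  by rewrite ler_expR ger0_norm//; nra.
have s0 : 0 < expR u by exact: expR_gt0.
have s1 : expR u <= 1 by rewrite -expR0 ler_expR ltW.
have d1 := pencil_ge1 x0 (ltW s0).
have : 1 - rsqrt_pencil x (expR u) <= pencil x 1 * expR u.
  have : pencil x (expR u) - 1 <= expR u * (pencil x 1 - 1).
    by rewrite lerBlDl; apply: pencil_le_linear; rewrite (ltW s0).
  have : 1 - rsqrt_pencil x (expR u) <= pencil x (expR u) - 1.
    have r1 : 1 <= Num.sqrt (pencil x (expR u)) by rewrite -[1]sqrtr1 ler_wsqrtr.
    have rr : Num.sqrt (pencil x (expR u)) ^+ 2 = pencil x (expR u).
      by rewrite sqr_sqrtr// (le_trans ler01).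
    rewrite /rsqrt_pencil; move: r1 rr; set r := Num.sqrt _ => r1 rr.
    have : r * r^-1 = 1 by rewrite mulfV// gt_eqF// (lt_le_trans ltr01).
    have : 0 < r^-1 by rewrite invr_gt0 (lt_le_trans ltr01).
    rewrite -rr; set t := r^-1; nra.
  nra.
move=> h; apply: (@le_trans _ _ (expR (q * u) * (pencil x 1 * expR u))).
  by rewrite ler_pM2l ?expR_gt0.
rewrite mulrCA -expRD ler_pM2l ?(lt_le_trans ltr01)// ler_expR ltr0_norm//; nra.
Qed.

End decay.

(** * Sign changes of exponential sums *)

Section expsum.
Context {R : realType}.

(** In the variable s = exp u this is a combination of the powers s^(p k). *)
Definition expsum n (c p : 'I_n -> R) (u : R) : R := \sum_k c k * expR (p k * u).

Lemma is_derive_expsum n (c p : 'I_n -> R) (u : R) :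
  is_derive u 1 (expsum c p) (expsum (fun k => c k * p k) p u).
Proof.
rewrite /expsum.
have -> : (fun u => \sum_k c k * expR (p k * u)) = \sum_k (fun u => c k * expR (p k * u)).
  by apply/funext => v; rewrite fct_sumE.
apply: is_derive_eq.
by apply: eq_bigr => k _; rewrite -[RHS]mulrA [X in _ = _ * X]mulrC /GRing.scale/= mulr1.
Qed.

Lemma expsumN n (c p : 'I_n -> R) u : expsum (fun k => - c k) p u = - expsum c p u.
Proof. by rewrite /expsum -sumrN; apply: eq_bigr => k _; rewrite mulNr. Qed.

Lemma expsum_shift n (c p : 'I_n -> R) a u :
  expsum c (fun k => p k - a) u = expsum c p u * expR (- (a * u)).
Proof.
rewrite /expsum mulr_suml; apply: eq_bigr => k _.
by rewrite mulrBl expRD mulrA.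
Qed.

(** This is the counting of sign changes in a Chebyshev system, by induction on
the number of terms: after multiplication by exp (- p_0 u) one term is constant,
and by the mean value theorem the derivative alternates at points interlacing
the given ones. Allowing zero values lets zeros of the sum fill any position of
the alternating sequence. *)
Lemma weak_alternation r (c p : 'I_r.+1 -> R) (X : nat -> R) : injective p ->
  (forall j, (j <= r)%N -> X j < X j.+1) ->
  (forall j, (j <= r.+1)%N -> 0 <= (-1) ^+ j * expsum c p (X j)) ->
  forall k, c k = 0.
Proof.
elim: r c p X => [|r IH] c p X pI Xinc alt.
  have cE u : expsum c p u = c ord0 * expR (p ord0 * u) by rewrite /expsum big_ord1.
  have := alt 0%N isT; have := alt 1%N isT; rewrite !cE expr0 expr1.
  rewrite mul1r mulN1r oppr_ge0 pmulr_lle0 ?expR_gt0// pmulr_lge0 ?expR_gt0// => a b k.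
  by rewrite (ord1 k); apply/eqP; rewrite eq_le a b.
pose p0 := p ord0.
(* Dividing by exp (p_0 u) makes the first term constant. *)
pose g := expsum c (fun k => p k - p0).
pose g' := expsum (fun k => c k * (p k - p0)) (fun k => p k - p0).
have dg (u : R) : is_derive u 1 g (g' u) := is_derive_expsum _ _ u.
have galt j : (j <= r.+2)%N -> 0 <= (-1) ^+ j * g (X j).
  by move=> jr; rewrite /g expsum_shift mulrA mulr_ge0 ?expR_ge0// alt.
have /choice[Y Yp] : forall j, exists y, (j <= r.+1)%N ->
    [/\ X j < y, y < X j.+1 & 0 <= (-1) ^+ j * (- g' y)].
  move=> j; have [jr|] := boolP (j <= r.+1)%N; last by move=> _; exists 0.
  have cg : {within `[X j, X j.+1], continuous g}.
    by apply: derivable_within_continuous => u _; have [] := dg u.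
  have [y] := @MVT R g g' (X j) (X j.+1) (Xinc j jr) (fun u _ => dg u) cg.
  rewrite in_itv/= => /andP[y1 y2] yE; exists y => _; split=> //.
  have d0 : 0 < X j.+1 - X j by rewrite subr_gt0 Xinc.
  rewrite -(pmulr_lge0 _ d0) mulrN mulNr -mulrA -yE.
  have := galt j.+1 jr; have := galt j (leqW jr); rewrite exprS; lra.
have g'E u : expsum (fun k => - (c (lift ord0 k) * (p (lift ord0 k) - p0)))
  (fun k => p (lift ord0 k) - p0) u = - g' u.
  by rewrite expsumN /g' /expsum [in RHS]big_ord_recl subrr mulr0 mul0r add0r.
have c0 k : c (lift ord0 k) = 0.
  have /eqP : - (c (lift ord0 k) * (p (lift ord0 k) - p0)) = 0.
    apply: (IH (fun k => - (c (lift ord0 k) * (p (lift ord0 k) - p0)))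
      (fun k => p (lift ord0 k) - p0) Y).
    - by move=> a b /addIr/pI/lift_inj.
    - move=> j jr; have [_ a _] := Yp j (leqW jr); have [b _ _] := Yp j.+1 jr.
      exact: lt_trans a b.
    - by move=> j jr; rewrite g'E; have [] := Yp j jr.
  rewrite oppr_eq0 mulf_eq0 subr_eq0 => /orP[/eqP//|/eqP/pI/eqP].
  by rewrite -[in X in X -> _](inj_eq val_inj).
have cE u : expsum c p u = c ord0 * expR (p ord0 * u).
  rewrite /expsum big_ord_recl big1 ?addr0// => k _; by rewrite c0 mul0r.
have c00 : c ord0 = 0.
  have := alt 0%N isT; have := alt 1%N isT; rewrite !cE expr0 expr1.
  rewrite mul1r mulN1r oppr_ge0 pmulr_lle0 ?expR_gt0// pmulr_lge0 ?expR_gt0// => a b.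
  by apply/eqP; rewrite eq_le a b.
by move=> k; case: (unliftP ord0 k) => [j ->|->].
Qed.

End expsum.

Section chebyshev.
Context {R : realType}.
Implicit Types (T : seq R) (u v t : R).

(** In the variable s = exp u this is the product of the s - s_t, whose sign
changes are exactly at T. *)
Definition node_prod T u : R := \prod_(t <- T) (expR u - expR t).

Lemma node_prod_cat T1 T2 u : node_prod (T1 ++ T2) u = node_prod T1 u * node_prod T2 u.
Proof. exact: big_cat. Qed.

Lemma node_prod_gt0 T u : all (fun t => t < u) T -> 0 < node_prod T u.
Proof.
elim: T => [|t T IH] /=; first by rewrite /node_prod big_nil.
move=> /andP[tu /IH h]; rewrite /node_prod big_cons mulr_gt0//.
by rewrite subr_gt0 ltr_expR.
Qed.

Lemma node_prod_sign T u : all (fun t => u < t) T -> 0 < (-1) ^+ size T * node_prod T u.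
Proof.
elim: T => [|t T IH] /=; first by rewrite /node_prod big_nil mulr1.
move=> /andP[tu /IH h]; rewrite /node_prod big_cons exprS mulrACA mulr_gt0//.
by rewrite mulN1r opprB subr_gt0 ltr_expR.
Qed.

(** Used to check an alternating pattern along T1, u, T2, v, T3 when the sum
vanishes on the Ti: only the positions of u and v matter. *)
Lemma nth_two_marks (V : eqType) (T1 T2 T3 : seq V) (u v x0 : V) (P : nat -> V -> Prop) :
  (forall j (t : V), t \in T1 ++ T2 ++ T3 -> P j t) ->
  P (size T1) u -> P (size T1 + size T2).+1 v ->
  forall j, (j < size (T1 ++ u :: T2 ++ v :: T3))%N ->
    P j (nth x0 (T1 ++ u :: T2 ++ v :: T3) j).
Proof.
move=> PT Pu Pv j; rewrite size_cat /= size_cat /= => jlt.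
rewrite nth_cat; case: ltnP => j1; first by apply: PT; rewrite mem_cat mem_nth.
case E : (j - size T1)%N => [|m] /=; first by rewrite (_ : j = size T1)//; lia.
rewrite nth_cat; case: ltnP => j2; first by apply: PT; rewrite !mem_cat mem_nth// orbT.
case E2 : (m - size T2)%N => [|l] /=.
  by rewrite (_ : j = (size T1 + size T2).+1)//; lia.
apply: PT; rewrite !mem_cat mem_nth ?orbT//; lia.
Qed.

(** If the signs of the sum relative to node_prod disagreed at u and v, the zeros
T together with u and v would be r + 2 points where a sum of r + 1 exponentials
weakly alternates, up to a global sign. *)
Lemma expsum_sign_lt r (c p : 'I_r.+1 -> R) T u v : injective p -> size T = r -> uniq T ->
  (forall t, t \in T -> expsum c p t = 0) -> (exists k, c k != 0) ->
  u \notin T -> v \notin T -> u < v ->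
  0 < (expsum c p u * node_prod T u) * (expsum c p v * node_prod T v).
Proof.
move=> pI sT uT T0 [k ck] uNT vNT uv; rewrite ltNge; apply/negP => le0.
move: ck => /negP; apply; apply/eqP; move: k.
pose S := sort <=%R T.
have ST : S =i T by move=> x; rewrite mem_sort.
have uS : uniq S by rewrite sort_uniq.
have sS : pairwise <%R S.
  by rewrite -(sorted_pairwise lt_trans) lt_sorted_uniq_le uS sort_le_sorted.
pose T1 := [seq t <- S | t < u].
pose T2 := [seq t <- S | u < t < v].
pose T3 := [seq t <- S | v < t].
have a1 : all (fun t => t < u) T1 by exact: filter_all.
have a2 : all (fun t => u < t < v) T2 by exact: filter_all.
have a3 : all (fun t => v < t) T3 by exact: filter_all.
have pT : perm_eq T (T1 ++ T2 ++ T3).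
  apply: uniq_perm => //.
    rewrite !cat_uniq !filter_uniq// !andbT /= -!all_predC; apply/andP; split.
      apply/allP => t; rewrite mem_cat => /orP[] /= h; apply/negP => /(allP a1) /=.
        by have /andP[ut _] := allP a2 _ h; rewrite ltNge (ltW ut).
      by have vt := allP a3 _ h; rewrite ltNge (ltW (lt_trans uv vt)).
    apply/allP => t h /=; apply/negP => /(allP a2) /andP[_].
    by have vt := allP a3 _ h; rewrite ltNge (ltW vt).
  move=> t; rewrite !mem_cat !mem_filter ST -!andb_orl.
  have [tT|] := boolP (t \in T); last by rewrite andbF.
  rewrite andbT; have := memPn uNT _ tT; have := memPn vNT _ tT.
  rewrite !neq_lt => /orP[h1|h1] /orP[h2|h2]; rewrite ?h1 ?h2 ?orbT//.
have sz : (size T1 + size T2 + size T3)%N = r.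
  by rewrite -sT (perm_size pT) !size_cat addnA.
have zero i t : t \in T1 ++ T2 ++ T3 -> 0 <= (-1) ^+ i * expsum c p t.
  by rewrite -(perm_mem pT) => /T0 ->; rewrite mulr0.
have npu : 0 < (-1) ^+ (size T2 + size T3) * node_prod T u.
  rewrite /node_prod (perm_big _ pT) /= -/(node_prod _ _) node_prod_cat mulrCA.
  rewrite mulr_gt0 ?node_prod_gt0// -size_cat node_prod_sign// all_cat.
  apply/andP; split; first by apply: sub_all a2 => t /andP[].
  by apply: sub_all a3 => t; exact: lt_trans.
have npv : 0 < (-1) ^+ size T3 * node_prod T v.
  rewrite /node_prod (perm_big _ pT) /= -/(node_prod _ _) catA node_prod_cat mulrCA.
  rewrite mulr_gt0 ?node_prod_sign// node_prod_gt0// all_cat; apply/andP; split.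
    by apply: sub_all a1 => t /lt_trans; apply.
  by apply: sub_all a2 => t /andP[].
(* Relative to the size of T2 between them, the values at u and v have the signs
   required of an alternating sequence. *)
have hh : (-1) ^+ size T2 * (expsum c p u * expsum c p v) <= 0.
  have : 0 < ((-1) ^+ (size T2 + size T3) * node_prod T u) * ((-1) ^+ size T3 * node_prod T v).
    exact: mulr_gt0.
  have e3 : ((-1) ^+ size T3 : R) ^+ 2 = 1 by rewrite sqrr_sign.
  have e2 : ((-1) ^+ size T2 : R) ^+ 2 = 1 by rewrite sqrr_sign.
  rewrite exprD; move: e2 e3 le0; set s2 := (-1) ^+ _; set s3 := (-1) ^+ _.
  set hu := expsum _ _ u; set hv := expsum _ _ v; set nu := node_prod _ u; set nv := node_prod _ v.
  move=> e2 e3 le0 pos.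
  have pos' : 0 < s2 * (nu * nv).
    by move: pos; rewrite (_ : _ * _ = s3 ^+ 2 * (s2 * (nu * nv))); [rewrite e3 mul1r|ring].
  rewrite leNgt; apply/negP => h; move: le0; apply/negP; rewrite -ltNge.
  rewrite (_ : _ * _ = s2 ^+ 2 * (hu * nu * (hv * nv))); last by rewrite e2 mul1r.
  rewrite (_ : _ * _ = (s2 * (hu * hv)) * (s2 * (nu * nv))); last by ring.
  exact: mulr_gt0.
pose pts := T1 ++ u :: T2 ++ v :: T3.
have spts : size pts = r.+2.
  by rewrite /pts size_cat /= size_cat /= !addnS addnA sz.
have inc : pairwise <%R pts.
  rewrite /pts pairwise_cat /= pairwise_cat /= !(sub_pairwise _ (pairwise_filter _ sS))//.
  rewrite !andbT !allrel_consr allrel_catr allrel_consr all_cat /= uv.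
  have m1 t : t \in T1 -> t < u by exact: (allP a1).
  have m2 t : t \in T2 -> u < t /\ t < v by move=> /(allP a2) /andP.
  have m3 t : t \in T3 -> v < t by exact: (allP a3).
  have all_lt (S1 : seq R) w : (forall t, t \in S1 -> t < w) -> all (fun t => t < w) S1.
    by move=> h; apply/allP.
  have all_gt (S1 : seq R) w : (forall t, t \in S1 -> w < t) -> all (fun t => w < t) S1.
    by move=> h; apply/allP.
  have rel_lt (S1 S2 : seq R) : (forall s t, s \in S1 -> t \in S2 -> s < t) -> allrel <%R S1 S2.
    by move=> h; apply/allrelP.
  rewrite a1 a3 /=; do ![apply/andP; split] => //.
  - by apply: rel_lt => s t /m1 su /m2[ut _]; exact: lt_trans ut.
  - by apply: all_lt => t /m1 tu; exact: lt_trans uv.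
  - by apply: rel_lt => s t /m1 su /m3 vt; exact: lt_trans (lt_trans su uv) vt.
  - by apply: all_gt => t /m2[].
  - by apply: all_gt => t /m3; exact: lt_trans.
  - by apply: all_lt => t /m2[].
  - by apply: rel_lt => s t /m2[_ sv] /m3; exact: lt_trans.
pose X := nth 0 pts.
have Xinc j : (j <= r)%N -> X j < X j.+1.
  move=> jr; have := inc; rewrite -(sorted_pairwise lt_trans).
  move=> /(sortedP 0)/(_ j); rewrite spts ltnS; exact.
have nthP (eps : R) : 0 <= eps * ((-1) ^+ size T1 * expsum c p u) ->
    0 <= eps * ((-1) ^+ (size T1 + size T2).+1 * expsum c p v) ->
    forall j, (j <= r.+1)%N -> 0 <= (-1) ^+ j * (eps * expsum c p (X j)).
  move=> hu hv j; rewrite -ltnS -spts mulrCA.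
  apply: (nth_two_marks 0 (P := fun j t => 0 <= eps * ((-1) ^+ j * expsum c p t))) => //.
  by move=> l t; rewrite -(perm_mem pT) => /T0 ->; rewrite !mulr0.
have : 0 <= ((-1) ^+ size T1 * expsum c p u) * ((-1) ^+ (size T1 + size T2).+1 * expsum c p v).
  have e1 : ((-1) ^+ size T1 : R) ^+ 2 = 1 by rewrite sqrr_sign.
  rewrite exprS exprD mulN1r.
  move: e1 hh; set s1 := (-1) ^+ _; set s2 := (-1) ^+ _ => e1 hh.
  rewrite (_ : _ * _ = - (s1 ^+ 2 * (s2 * (expsum c p u * expsum c p v)))); last by ring.
  by rewrite e1 mul1r oppr_ge0.
set a := _ ^+ _ * _; set b := _ ^+ _ * _ => ab.
(* A global sign for which both values fit the pattern, one of them being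
   possibly zero. *)
have [eps [eps0 ea eb]] : exists eps, [/\ eps != 0, 0 <= eps * a & 0 <= eps * b].
  have [a0|a0] := leP 0 a; have [b0|b0] := leP 0 b.
  - by exists 1; rewrite !mul1r oner_eq0.
  - by exists (-1); rewrite oppr_eq0 oner_eq0; split => //; nra.
  - by exists (-1); rewrite oppr_eq0 oner_eq0; split => //; nra.
  - by exists (-1); rewrite oppr_eq0 oner_eq0; split => //; nra.
move=> k; apply: (mulfI eps0); rewrite mulr0; move: k.
apply: (@weak_alternation _ r (fun k => eps * c k) p X) => // j jr.
rewrite (_ : expsum _ _ _ = eps * expsum c p (X j)); first exact: nthP.
by rewrite /expsum mulr_sumr; apply: eq_bigr => k _; rewrite mulrA.
Qed.

(** A sum of r + 1 exponentials with r zeros changes sign at each of them and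
nowhere else, since its sign relative to node_prod is constant. *)
Lemma expsum_sign r (c p : 'I_r.+1 -> R) T u v : injective p -> size T = r -> uniq T ->
  (forall t, t \in T -> expsum c p t = 0) -> (exists k, c k != 0) ->
  u \notin T -> v \notin T ->
  0 < (expsum c p u * node_prod T u) * (expsum c p v * node_prod T v).
Proof.
move=> pI sT uT T0 c0 uT' vT'.
have h := expsum_sign_lt pI sT uT T0 c0.
case: (ltgtP u v) => [uv|vu|uv]; first exact: h.
  by rewrite mulrC; exact: h.
(* For u = v the claim is that the sum is nonzero at u; compare with a point
   beyond all nodes. *)
subst v; pose w := \big[Num.max/u]_(t <- T) t + 1.
have tw t : t \in T -> t < w.
  by move=> tT; rewrite /w ltr_pwDr// le_bigmax_seq.
have uw : u < w by rewrite /w ltr_pwDr// bigmax_ge_id.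
have wT : w \notin T by apply/negP => /tw; rewrite ltxx.
have := h u w uT' wT uw; set a := expsum c p u * _.
rewrite -expr2 => aw; rewrite exprn_even_gt0//=.
by apply: contraTneq aw => ->; rewrite mul0r ltxx.
Qed.

(** There are more coefficients than linear conditions. *)
Lemma expsum_interpolation r (p : 'I_r.+1 -> R) T : size T = r ->
  exists2 c : 'I_r.+1 -> R, (exists k, c k != 0) & forall t, t \in T -> expsum c p t = 0.
Proof.
move=> sT.
pose A := \matrix_(k < r.+1, j < r) expR (p k * nth 0 T j).
have : kermx A != 0.
  rewrite kermx_eq0 /row_free; apply/eqP => h.
  by have := rank_leq_col A; rewrite h ltnn.
move=> /matrix0Pn[i [k ik]].
exists (fun k => kermx A i k); first by exists k.
move=> t /(nthP 0)[j]; rewrite sT => jr <-.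
have /rowP/(_ (Ordinal jr)) : row i (kermx A) *m A = 0.
  by rewrite -row_mul mulmx_ker row0.
rewrite mxE [RHS]mxE => e; rewrite -[RHS]e; apply: eq_bigr => l _.
by rewrite [row _ _ _ _]mxE [A _ _]mxE.
Qed.

(** T collects the positive roots of odd multiplicity: a root found twice is
moved to the factor Q, where its square does not affect the sign. *)
Lemma poly_sign_split (P : {poly R}) : P != 0 ->
  exists T (Q : {poly R}), [/\ uniq T, all (fun t => 0 < t) T,
    P = \prod_(t <- T) ('X - t%:P) * Q &
    (forall s, 0 < s -> 0 <= Q.[s]) \/ (forall s, 0 < s -> Q.[s] <= 0)].
Proof.
have [m] := ubnP (size P); elim: m P => // m IH P sP P0.
have [[t [t0 rt]]|nr] := pselect (exists t, 0 < t /\ root P t); last first.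
  exists [::], P; rewrite big_nil mul1r; split=> //.
  have [|h] := pselect (forall s, 0 < s -> 0 <= P.[s]); first by left.
  right => s s0; rewrite leNgt; apply/negP => Ps; apply: h => v v0.
  rewrite leNgt; apply/negP => Pv; apply: nr.
  have [vs|sv] := leP v s.
    have [|x /andP[vx _] rx] := poly_ivt (p := P) vs; first by rewrite !ltW.
    by exists x; split=> //; exact: lt_le_trans vx.
  have [|x /andP[sx _] rx] := poly_ivt (p := - P) (ltW sv).
    by rewrite !hornerN oppr_le0 oppr_ge0 !ltW.
  by exists x; split; [exact: lt_le_trans sx|rewrite -rootN].
have [P1 PE] := factor_theorem _ _ rt.
have P10 : P1 != 0 by apply: contraNneq P0 => P10; rewrite PE P10 mul0r.
have sP1 : (size P1 < m)%N.
  by move: sP; rewrite PE size_Mmonic ?monicXsubC// size_XsubC addn2 /= ltnS.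
have [T [Q [uT aT P1E Qs]]] := IH P1 sP1 P10.
have [tT|tT] := boolP (t \in T); last first.
  exists (t :: T), Q; rewrite /= tT uT t0 aT; split=> //.
  by rewrite PE P1E big_cons; ring.
exists (rem t T), (('X - t%:P) ^+ 2 * Q); split.
- exact: rem_uniq.
- by apply/allP => x /mem_rem /(allP aT).
- rewrite PE P1E (perm_big _ (perm_to_rem tT)) /= big_cons; ring.
- have Qsq s : (('X - t%:P) ^+ 2 * Q).[s] = (s - t) ^+ 2 * Q.[s].
    by rewrite hornerM horner_exp hornerXsubC.
  case: Qs => h; [left|right] => s s0; rewrite Qsq.
    by rewrite mulr_ge0 ?sqr_ge0 ?h.
  by rewrite mulr_ge0_le0 ?sqr_ge0 ?h.
Qed.

Lemma poly_roots_seq (P : {poly R}) : P != 0 -> exists s : seq R, forall x, root P x -> x \in s.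
Proof.
have [m] := ubnP (size P); elim: m P => // m IH P sP P0.
have [[t rt]|nr] := pselect (exists t, root P t); last first.
  by exists [::] => x rx; case: nr; exists x.
have [P1 PE] := factor_theorem _ _ rt.
have P10 : P1 != 0 by apply: contraNneq P0 => P10; rewrite PE P10 mul0r.
have sP1 : (size P1 < m)%N.
  by move: sP; rewrite PE size_Mmonic ?monicXsubC// size_XsubC addn2 /= ltnS.
have [s hs] := IH P1 sP1 P10; exists (t :: s) => x.
by rewrite PE rootM root_XsubC in_cons => /orP[/hs ->|->]; rewrite ?orbT.
Qed.

Lemma exists_notin (s : seq R) : exists u, u \notin s.
Proof.
exists (\big[Num.max/0]_(t <- s) t + 1); apply/negP => h.
have : \big[Num.max/0]_(t <- s) t + 1 <= \big[Num.max/0]_(t <- s) t by exact: le_bigmax_seq h _.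
by rewrite leNgt ltrDl ltr01.
Qed.
End chebyshev.

(** * A polynomial orthogonal to enough exponentials vanishes *)

Section vanish.
Context {R : realType}.
Local Notation mu := (@lebesgue_measure R).

(** A null set together with a finite set cannot cover the unit interval. *)
Lemma integral_gt0_off_finite (G : R -> R) (s : seq R) :
  mu.-integrable [set: measurableTypeR R] (EFin \o G) ->
  (forall u, 0 <= G u) -> (forall u, u \notin s -> G u != 0) ->
  (\int[mu]_u (G u)%:E)%E <> 0%E.
Proof.
move=> iG G0 Gs I0.
have mG := measurable_int _ iG.
have : (\int[mu]_u `|(EFin \o G) u|)%E = 0%E.
  by rewrite -[RHS]I0; apply: eq_integral => u _; rewrite /= ger0_norm.
move/(ae_eq_integral_abs mu measurableT mG) => [N [mN N0 GN]].
have ms : measurable ([set` s] : set (measurableTypeR R)).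
  by apply: countable_measurable => [t|]; [exact: measurable_set1|]; apply: finite_set_countable; apply/finite_seqP; exists s.
have s0 : mu [set` s] = 0%E.
  by apply: countable_lebesgue_measure0; apply: finite_set_countable; apply/finite_seqP; exists s.
have : (mu `[0%R, 1%R]%classic <= mu (N `|` [set` s]))%E.
  apply: le_measure; rewrite ?inE//; first exact: measurableU.
  move=> u _; have [us|us] := boolP (u \in s); [by right|left].
  by apply: GN => /= /(_ I) [] /eqP; rewrite (negbTE (Gs u us)).
apply/negP; rewrite -ltNge.
apply: (@le_lt_trans _ _ (mu N + mu [set` s])%E); first exact: measureU2.
by rewrite N0 s0 adde0 lebesgue_measure_itv/= lte_fin ltr01 sube0 lte_fin.
Qed.

(** If P is nonzero, then it has fewer positive sign changes than there are
exponents, and some combination of the exponentials changes sign exactly there.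
The product of this combination with D has constant sign, vanishes only at
finitely many points, and integrates to zero. *)
Lemma poly_vanish (P : {poly R}) (qs : seq R) (D W : R -> R) :
  uniq qs -> (size P <= size qs)%N ->
  (forall u, 0 < W u) -> (forall u, D u = W u * P.[expR u]) ->
  (forall q, q \in qs ->
     mu.-integrable [set: measurableTypeR R] (fun u => (expR (q * u) * D u)%:E) /\
     (\int[mu]_u (expR (q * u) * D u)%:E = 0)%E) ->
  P = 0.
Proof.
move=> uqs sP W0 DE H; apply/eqP; apply/negPn/negP => P0.
have [T [Q [uT aT PE Qs]]] := poly_sign_split P0.
have Q0 : Q != 0 by apply: contraNneq P0 => Q0; rewrite PE Q0 mulr0.
pose r := size T.
have rqs : (r < size qs)%N.
  apply: leq_trans sP; rewrite PE size_monicM ?monic_prod_XsubC//.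
  by rewrite size_prod_XsubC addSn /= -[ltnLHS]addn0 ltn_add2l size_poly_gt0.
pose p (k : 'I_r.+1) := nth 0 qs k.
have kqs (k : 'I_r.+1) : (k < size qs)%N by apply: leq_trans rqs.
have pI : injective p.
  by move=> a b /eqP; rewrite nth_uniq ?kqs// => /eqP/val_inj.
have pqs k : p k \in qs by rewrite mem_nth.
pose T' := [seq ln t | t <- T].
have sT' : size T' = r by rewrite size_map.
have uT' : uniq T'.
  rewrite map_inj_in_uniq// => a b aT' bT'; apply: ln_inj; rewrite posrE.
    exact: (allP aT).
  exact: (allP aT).
have npE u : node_prod T' u = (\prod_(t <- T) ('X - t%:P)).[expR u].
  rewrite /node_prod big_map horner_prod; apply: eq_big_seq => t tT.
  by rewrite hornerXsubC lnK// posrE (allP aT).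
have [c c0 cT] := @expsum_interpolation R r p T' sT'.
pose h := expsum c p.
pose a u := h u * node_prod T' u.
(* The sign at u0 normalizes the combination h. *)
have [u0 u0T] := exists_notin T'.
have a_pos u : u \notin T' -> 0 < a u0 * a u.
  by move=> uN; exact: (expsum_sign pI sT' uT' cT c0).
have a_zero u : u \in T' -> h u = 0 by exact: cT.
have [e e0 eQ] : exists2 e : R, e != 0 & forall s, 0 < s -> 0 <= e * Q.[s].
  case: Qs => hQ; [exists 1|exists (-1)] => //; rewrite ?oppr_eq0 ?oner_eq0//.
    by move=> s s0; rewrite mul1r hQ.
  by move=> s s0; rewrite mulN1r oppr_ge0 hQ.
have [roots Hroots] := poly_roots_seq Q0.
pose G u := (e * a u0) * (h u * D u).
have GE u : G u = W u * (a u0 * a u) * (e * Q.[expR u]).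
  by rewrite /G DE PE hornerM /a !npE; ring.
have Hsum u : h u * D u = \sum_k c k * (expR (p k * u) * D u).
  by rewrite /h /expsum mulr_suml; apply: eq_bigr => k _; rewrite mulrA.
have iH : mu.-integrable [set: measurableTypeR R] (fun u => (h u * D u)%:E).
  rewrite (_ : (fun u => _) = (fun u => \sum_k (c k)%:E * (expR (p k * u) * D u)%:E))%E.
    apply: integrable_sum => // k _; apply: integrableZl => //.
    by have [] := H _ (pqs k).
  by apply/funext => u; rewrite Hsum -sumEFin.
have IH : (\int[mu]_u (h u * D u)%:E = 0)%E.
  rewrite (_ : (fun u => _) = (fun u => \sum_k (c k)%:E * (expR (p k * u) * D u)%:E))%E; last first.
    by apply/funext => u; rewrite Hsum -sumEFin.
  rewrite integral_sum//; last first.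
    by move=> k; apply: integrableZl => //; have [] := H _ (pqs k).
  apply: big1 => k _; have [iD ID] := H _ (pqs k).
  by rewrite integralZl// ID mule0.
apply: (@integral_gt0_off_finite G (T' ++ [seq ln t | t <- roots])).
- rewrite (_ : EFin \o G = (fun u => (e * a u0)%:E * (h u * D u)%:E)%E)//.
  exact: integrableZl.
- move=> u; have [uT1|uT1] := boolP (u \in T').
    by rewrite /G a_zero// mul0r mulr0.
  by rewrite GE mulr_ge0// ?eQ ?expR_gt0// mulr_ge0// ltW ?a_pos.
- move=> u; rewrite mem_cat negb_or => /andP[uT1 uR].
  rewrite GE; apply: mulf_neq0; first by rewrite mulf_neq0// gt_eqF// a_pos.
  apply: mulf_neq0 => //.
  apply/negP => Qu; move: uR; rewrite -[u](expRK u) map_f// Hroots//.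
- rewrite (_ : (fun u => _) = (fun u => (e * a u0)%:E * (h u * D u)%:E)%E)//.
  by rewrite integralZl// IH mule0.
Qed.
End vanish.

(** * Ellipsoids with the same pencil are congruent *)

Section congruence.
Context {R : realType} (n : nat).
Implicit Types (x : 'rV[R]_n) (U : 'M[R]_n).

Lemma sqn_mulmx (z : 'rV[R]_n) U : U *m U^T = 1%:M -> sqn (z *m U) = sqn z.
Proof.
move=> UU; rewrite !sqn_qform /qform !mulmx1 trmx_mul mulmxA -(mulmxA z) UU.
by rewrite mulmx1.
Qed.

Lemma sqn_col_perm (s : 'S_n) (z : 'rV[R]_n) : sqn (col_perm s z) = sqn z.
Proof.
rewrite /sqn [RHS](reindex_inj (@perm_inj _ s)).
by apply: eq_bigr => k _; rewrite mxE.
Qed.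

(** The isometry passes to the principal axes of the first ellipsoid, permutes
them, and passes back along the axes of the second. *)
Lemma congruent_ell x1 x2 U1 U2 (s : 'S_n) :
  U1 *m U1^T = 1%:M -> U2 *m U2^T = 1%:M -> (forall k, x2 0 k = x1 0 (s k)) ->
  congruent (qball (ell_mx x1 U1)) (qball (ell_mx x2 U2)).
Proof.
move=> UU1 UU2 xs.
have UtU1 : U1^T *m U1 = 1%:M by exact: mulmx1C.
have UtU2 : U2^T *m U2 = 1%:M by exact: mulmx1C.
pose f (y : 'rV[R]_n) : 'rV[R]_n := col_perm s (y *m U1^T) *m U2.
have Qf y : qform (ell_mx x2 U2) (f y) = qform (ell_mx x1 U1) y.
  rewrite !qform_ell /f -mulmxA UU2 mulmx1 [RHS](reindex_inj (@perm_inj _ s)).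
  by apply: eq_bigr => k _; rewrite mxE xs.
exists f.
  move=> a b; rewrite !enormE; congr Num.sqrt.
  have -> : f a - f b = col_perm s ((a - b) *m U1^T) *m U2.
    by rewrite /f -mulmxBl; congr (_ *m _); rewrite mulmxBl; apply/rowP => k; rewrite !mxE.
  by rewrite sqn_mulmx// sqn_col_perm sqn_mulmx// trmxK.
apply/seteqP; split=> w /=; last by move=> [y yE <-]; rewrite /qball/= Qf.
move=> wE; pose y := col_perm (s^-1)%g (w *m U2^T) *m U1.
have fy : f y = w.
  rewrite /f /y -(mulmxA _ U1) UU1 mulmx1 -col_permM mulgV col_perm1.
  by rewrite -mulmxA UtU2 mulmx1.
by exists y => //; move: wE; rewrite /qball/= -{1}fy Qf.
Qed.

Definition pencil_poly x : {poly R} := \prod_k (1 + (x 0 k)%:P * 'X).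

Lemma horner_pencil_poly x s : (pencil_poly x).[s] = pencil x s.
Proof.
rewrite /pencil_poly horner_prod; apply: eq_bigr => k _.
by rewrite !hornerE mulrC.
Qed.

Lemma pencil_polyE x : (forall k, 0 < x 0 k) ->
  pencil_poly x = (\prod_k x 0 k)%:P *
    \prod_(t <- [seq - (x 0 k)^-1 | k <- enum 'I_n]) ('X - t%:P).
Proof.
move=> x0; rewrite big_map big_enum /= rmorph_prod -big_split /=.
apply: eq_bigr => k _; rewrite mulrBr -polyCM mulrN mulfV ?gt_eqF//.
by rewrite polyCN opprK addrC.
Qed.

Lemma lead_pencil_poly x : (forall k, 0 < x 0 k) -> lead_coef (pencil_poly x) = \prod_k x 0 k.
Proof.
move=> x0; rewrite pencil_polyE// lead_coef_Mmonic ?monic_prod_XsubC//.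
by rewrite lead_coefC.
Qed.

Lemma size_pencil_poly x : (forall k, 0 < x 0 k) -> size (pencil_poly x) = n.+1.
Proof.
move=> x0; rewrite pencil_polyE// size_Cmul.
  by rewrite size_prod_XsubC size_map size_enum_ord.
by rewrite gt_eqF// prodr_gt0.
Qed.

Lemma coef_pencil_poly x : (forall k, 0 < x 0 k) -> (pencil_poly x)`_n = \prod_k x 0 k.
Proof. by move=> x0; rewrite -lead_pencil_poly// lead_coefE size_pencil_poly. Qed.

(** The roots of the pencil are the - 1 / x_k. *)
Lemma pencil_poly_perm x1 x2 : (forall k, 0 < x1 0 k) -> (forall k, 0 < x2 0 k) ->
  pencil_poly x1 = pencil_poly x2 -> exists s : 'S_n, forall k, x2 0 k = x1 0 (s k).
Proof.
move=> x10 x20 e12.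
have := e12; rewrite !pencil_polyE// -(lead_pencil_poly x10) -(lead_pencil_poly x20) e12.
have l0 : (lead_coef (pencil_poly x2))%:P != 0.
  by rewrite polyC_eq0 lead_pencil_poly// gt_eqF// prodr_gt0.
move=> /(mulfI l0)/prod_XsubC_eq; rewrite perm_sym.
pose t x := [tuple - (x 0 k)^-1 | k < n].
have tE x : [seq - (x 0 k)^-1 | k <- enum 'I_n] = t x by [].
rewrite !tE => /tuple_permP[s]/= h; exists s => k.
have : nth 0 (t x2) k = nth 0 [tuple tnth (t x1) (s i) | i < n] k by exact: (congr1 (fun l => nth 0 l k) h).
rewrite -!tnth_nth !tnth_mktuple => /oppr_inj/invr_inj//.
Qed.
End congruence.

(** * Equality of the pencils *)

Section main.
Context {R : realType} (n : nat).
Local Notation mu := (@lebesgue_measure R).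
Variables (x1 x2 : 'rV[R]_n) (U1 U2 : 'M[R]_n).
Hypotheses (n0 : (0 < n)%N) (x10 : forall k, 0 < x1 0 k) (x20 : forall k, 0 < x2 0 k)
  (UU1 : U1 *m U1^T = 1%:M) (UU2 : U2 *m U2^T = 1%:M).

Definition rsqrt_pencil_diff (u : R) : R := rsqrt_pencil x1 (expR u) - rsqrt_pencil x2 (expR u).

Let measurable_expM (q : R) : measurable_fun [set: measurableTypeR R]
  (fun u : measurableTypeR R => expR (q * u) : measurableTypeR R).
Proof. by apply: (measurableT_comp (f := expR)) => //; exact: measurable_funM. Qed.

(** For i < 0 only the moments of 1 - p^(-1/2) converge, but the constant 1
disappears in the difference of the two pencils. *)
Lemma moment_rsqrt_pencil_diff (i : R) : i != 0 -> -2 < i -> i < n%:R ->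
  dual_volume i (qball (ell_mx x1 U1)) = dual_volume i (qball (ell_mx x2 U2)) ->
  mu.-integrable [set: measurableTypeR R] (fun u => (expR (i / 2 * u) * rsqrt_pencil_diff u)%:E) /\
  (\int[mu]_u (expR (i / 2 * u) * rsqrt_pencil_diff u)%:E = 0)%E.
Proof.
move=> i0 i2 lt_in; set q := i / 2.
suff [f1 [f2 [i1 i2' I12 fE]]] : exists f1 f2 : R -> R,
    [/\ mu.-integrable [set: measurableTypeR R] (EFin \o f1),
        mu.-integrable [set: measurableTypeR R] (EFin \o f2),
        dual_volume i (qball (ell_mx x1 U1)) = dual_volume i (qball (ell_mx x2 U2)) ->
          (\int[mu]_u (f1 u)%:E = \int[mu]_u (f2 u)%:E)%E &
        forall u, expR (q * u) * rsqrt_pencil_diff u = f1 u - f2 u].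
  have e : (fun u => (expR (q * u) * rsqrt_pencil_diff u)%:E) = (fun u => (f1 u)%:E - (f2 u)%:E)%E.
    by apply/funext => u; rewrite fE EFinB.
  have B := @integralB_EFin _ _ _ mu setT f1 f2 measurableT i1 i2'.
  have fin2 : (\int[mu]_u (f2 u)%:E)%E \is a fin_num.
    exact: (integrable_fin_num measurableT i2').
  rewrite e => /I12 I; split; first exact: integrableB.
  rewrite B I; exact: subee.
have powE (K : R -> R) : (\int[mu]_u (expR u `^ q * K u)%:E = \int[mu]_u (expR (q * u) * K u)%:E)%E.
  by apply: eq_integral => u _; rewrite powR_expR.
have mF1 := measurable_rsqrt_pencil x10.
have mF2 := measurable_rsqrt_pencil x20.
have [ipos|ineg] : 0 < i \/ i < 0 by case: (ltgtP i 0) i0; [right|left|].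
  have q0 : 0 < q < n%:R / 2 by rewrite /q divr_gt0//= ltr_pM2r ?invr_gt0.
  have d0 : 0 < Num.min q (n%:R / 2 - q).
    by case/andP: q0 => qa qb; rewrite lt_min qa subr_gt0.
  exists (fun u => expR (q * u) * rsqrt_pencil x1 (expR u)), (fun u => expR (q * u) * rsqrt_pencil x2 (expR u)).
  split.
  - apply: (integrable_exp_decay d0); first by apply: measurable_funM; [exact: measurable_expM|].
    by move=> u; exact: rsqrt_pencil_decay.
  - apply: (integrable_exp_decay d0); first by apply: measurable_funM; [exact: measurable_expM|].
    by move=> u; exact: rsqrt_pencil_decay.
  - move=> /(moment_pos n0 x10 x20 UU1 UU2 ipos) h.
    exact: etrans (esym (powE _)) (etrans h (powE _)).
  - by move=> u; rewrite /rsqrt_pencil_diff mulrBr.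
have q0 : -1 < q < 0.
  by apply/andP; split; rewrite /q; lra.
have d0 : 0 < Num.min (- q) (1 + q).
  by case/andP: q0 => qa qb; rewrite lt_min; apply/andP; split; lra.
exists (fun u => expR (q * u) * (1 - rsqrt_pencil x2 (expR u))), (fun u => expR (q * u) * (1 - rsqrt_pencil x1 (expR u))).
split.
- apply: (integrable_exp_decay d0).
    by apply: measurable_funM; [exact: measurable_expM|exact: measurable_funB].
  by move=> u; exact: sub1_rsqrt_pencil_decay.
- apply: (integrable_exp_decay d0).
    by apply: measurable_funM; [exact: measurable_expM|exact: measurable_funB].
  by move=> u; exact: sub1_rsqrt_pencil_decay.
- move=> /(moment_neg n0 x10 x20 UU1 UU2 ineg) h.
  exact: etrans (esym (powE _)) (etrans (esym h) (powE _)).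
- by move=> u; rewrite /rsqrt_pencil_diff; ring.
Qed.

(** Rationalizing the difference of the inverse square roots. *)
Lemma rsqrt_pencil_diff_sign u : exists2 w, 0 < w &
  rsqrt_pencil_diff u = w * (pencil x2 (expR u) - pencil x1 (expR u)).
Proof.
have d1 := pencil_gt0 x10 (expR_ge0 u); have d2 := pencil_gt0 x20 (expR_ge0 u).
set a := Num.sqrt (pencil x1 (expR u)); set b := Num.sqrt (pencil x2 (expR u)).
have a0 : 0 < a by rewrite sqrtr_gt0.
have b0 : 0 < b by rewrite sqrtr_gt0.
have aE : pencil x1 (expR u) = a ^+ 2 by rewrite sqr_sqrtr// ltW.
have bE : pencil x2 (expR u) = b ^+ 2 by rewrite sqr_sqrtr// ltW.
exists (a * b * (a + b))^-1; first by rewrite invr_gt0 !mulr_gt0// addr_gt0.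
rewrite aE bE /rsqrt_pencil_diff /rsqrt_pencil -/a -/b; field.
by rewrite !gt_eqF// addr_gt0.
Qed.

(** The polynomial P = (p2 - p1) / X has at most n coefficients. When some order
equals n, its moment is missing, but the volumes agree and the top coefficient
of P vanishes as well, so that there are always enough exponents. *)
Lemma pencil_poly_eq (i : 'I_n -> R) : injective i ->
  (forall k, i k != 0 /\ -2 < i k <= n%:R) ->
  (forall k, dual_volume (i k) (qball (ell_mx x1 U1)) = dual_volume (i k) (qball (ell_mx x2 U2))) ->
  pencil_poly x1 = pencil_poly x2.
Proof.
move=> iI iP V12.
have top k : i k = n%:R -> \prod_l x1 0 l = \prod_l x2 0 l.
  by move=> ik; apply: (moment_dim n0 x10 x20 UU1 UU2); rewrite -ik; exact: V12.
have orth k : i k != n%:R ->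
    mu.-integrable [set: measurableTypeR R] (fun u => (expR (i k / 2 * u) * rsqrt_pencil_diff u)%:E) /\
    (\int[mu]_u (expR (i k / 2 * u) * rsqrt_pencil_diff u)%:E = 0)%E.
  move=> ikn; have [ik0 /andP[ik2 ikle]] := iP k.
  by apply: (moment_rsqrt_pencil_diff ik0 ik2); [rewrite lt_neqAle ikn|exact: V12].
move=> {V12}.
pose P0 := pencil_poly x2 - pencil_poly x1.
have : root P0 0.
  rewrite rootE hornerD hornerN !horner_pencil_poly /pencil.
  by rewrite !big1 ?subrr// => k _; rewrite mul0r addr0.
move=> /factor_theorem[P]; rewrite subr0 => P0E.
suff P_eq0 : P = 0 by apply/eqP; rewrite eq_sym -subr_eq0 -/P0 P0E P_eq0 mul0r.
(* The order n has no moment and is set apart. *)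
pose I := [seq k <- enum 'I_n | i k != n%:R].
pose qs := [seq i k / 2 | k <- I].
have uqs : uniq qs.
  have uI : uniq I by apply: filter_uniq; exact: enum_uniq.
  rewrite map_inj_uniq// => a b.
  by move=> /(mulIf _) h; apply: iI; apply: h; rewrite invr_neq0.
have sP0 : (size P0 <= n.+1)%N.
  rewrite (leq_trans (size_polyD _ _))// size_polyN !size_pencil_poly//.
  by rewrite maxnn.
have sPle m : (size P0 <= m.+1)%N -> (size P <= m)%N.
  have [->|Pn0] := eqVneq P 0; first by rewrite size_poly0.
  by rewrite P0E size_mulX// ltnS.
have sizes : (size P <= size qs)%N.
  rewrite size_map.
  have [/existsP[k0 /eqP ik0]|/existsPn nk] := boolP [exists k, i k == n%:R].
    have -> : size I = n.-1.
      rewrite /I (eq_filter (a2 := predC1 k0)); last first.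
        by move=> k /=; rewrite -ik0 (inj_eq iI).
      rewrite size_filter -[in RHS](size_enum_ord n) -(count_predC (pred1 k0)).
      by rewrite (count_uniq_mem _ (enum_uniq _)) mem_enum.
    apply: sPle; rewrite prednK//.
    have e := top _ ik0.
    apply/leq_sizeP => j; rewrite leq_eqVlt => /orP[/eqP <-|nj].
      rewrite coefB.
      by rewrite (coef_pencil_poly x20) (coef_pencil_poly x10) e subrr.
    by apply/leq_sizeP: nj; exact: sP0.
  have -> : size I = n.
    rewrite /I (eq_filter (a2 := predT)) ?filter_predT ?size_enum_ord//.
  exact: sPle.
have /choice[w wP] : forall u, exists w, 0 < w /\
   rsqrt_pencil_diff u = w * (pencil x2 (expR u) - pencil x1 (expR u)).
  by move=> u; have [w] := rsqrt_pencil_diff_sign u; exists w.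
apply: (@poly_vanish R P qs rsqrt_pencil_diff (fun u => w u * expR u)) => //.
- by move=> u; rewrite mulr_gt0 ?expR_gt0//; have [] := wP u.
- move=> u; have [_ ->] := wP u.
  have : P0.[expR u] = pencil x2 (expR u) - pencil x1 (expR u).
    by rewrite hornerD hornerN !horner_pencil_poly.
  by rewrite P0E hornerMX => <-; ring.
- move=> q /mapP[k]; rewrite mem_filter => /andP[ikn _] ->.
  exact: orth.
Qed.
End main.

Theorem mainTheorem2 (R : realType) (n : nat) (i : 'I_n -> R)
    (E1 E2 : set 'rV[R]_n) :
  (2 <= n)%N ->
  injective i ->
  (forall k, i k != 0 /\ -2 < i k <= n%:R) ->
  ellipsoid E1 ->
  ellipsoid E2 ->
  (forall k, dual_volume (i k) E1 = dual_volume (i k) E2) ->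
  congruent E1 E2.
Proof.
move=> n2 iI iP /ellipsoidP[x1 [U1 [x10 UU1 ->]]] /ellipsoidP[x2 [U2 [x20 UU2 ->]]] V12.
have n0 : (0 < n)%N by exact: leq_trans n2.
have /(pencil_poly_perm x10 x20)[s xs] := pencil_poly_eq n0 x10 x20 UU1 UU2 iI iP V12.
exact: congruent_ell xs.
Qed.
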